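(* Let $F\in C^{m_r+1,n_r+1}([a,b]\times[c,d])$ with $b-a=d-c=h$. Then $$\|F-\mathbf B_{\mathbf m,\mathbf n}F\|_{\infty,[a,b]\times[c,d]}\le C_{\mathbf m,\mathbf n}(F)\,h^p$$ with $$p=\min\{m_{k-1}+n_{r-k}+2 : k=0,\dots,r+1\},\qquad m_{-1}:=-1=:n_{-1},$$ with respect to the constant $$C_{\mathbf m,\mathbf n}(F)=\sum_{k=0}^{r+1}K_{m_{k-1},n_{r-k}}(F)+\sum_{k=0}^{r}K_{m_k,n_{r-k}}(F),$$ where $$K_{m_k,n_\ell}(F):=(1+\|\mathbf P_{m_k}\oplus\mathbf Q_{n_\ell}\|)\,\frac{\|F^{(m_k+1,n_\ell+1)}\|_{\infty,[a,b]\times[c,d]}}{2^{m_k+n_\ell+2}(m_k+1)!\,(n_\ell+1)!},$$ and, for $0\le k,\ell\le r$, $$\|\mathbf P_{m_k}\oplus\mathbf Q_{n_\ell}\|\le C_{m_r,m_k}+C_{n_r,n_\ell}+C_{m_r,m_k}C_{n_r,n_\ell},$$ where $C_{m_r,m_k}=C_{m_r}(m_k+1)\|E_{m_k}^{m_r}(\alpha^k,:)^{-1}\|_\infty$ and $C_{n_r,n_\ell}=C_{n_r}(n_\ell+1)\|E_{n_\ell}^{n_r}(\beta^\ell,:)^{-1}\|_\infty$ are constants depending only on $m_r,m_k$ and on $n_r,n_\ell$, respectively.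
   Context: Fix an integer $r\ge 0$, real intervals $[a,b]$ and $[c,d]$ with $a<b$, $c<d$, and strictly increasing sequences $\mathbf m=[m_0,\dots,m_r]$, $\mathbf n=[n_0,\dots,n_r]$ of non-negative integers with $m_k\mid m_{k+1}$ and $n_k\mid n_{k+1}$ for $0\le k\le r-1$. (An entry can then be $0$ only if $r=0$; in that case the quotients $i/N$, $i\,m_r/m_k$, $j\,n_r/n_k$ below, which occur only with $i=0$ or $j=0$, are read as $0$.) $\Pi_N$ is the space of real univariate polynomials of degree at most $N$. Quantities with $m_k$ refer to the first variable and $[a,b]$; those with $n_k$ refer to the second variable and $[c,d]$. Functionals: for $N=m_k$, let $B_i^N(x)=\binom{N}{i}\left(\frac{b-x}{b-a}\right)^{N-i}\left(\frac{x-a}{b-a}\right)^i$, $0\le i\le N$, $x_i^N=a+\frac{i}{N}(b-a)$, $T_N=[B_j^N(x_i^N)]_{0\le i,j\le N}$ (invertible), and $\lambda_i^N f=\sum_{s=0}^N (T_N^{-1})_{is}f(x_s^N)$ for $f\in C[a,b]$; the $\lambda_j^{n_k}$ on $C[c,d]$ are defined in the same way on $[c,d]$. Let $C_N$ be a constant depending only on $N$ with $|\lambda_i^N f|\le C_N\|f\|_\infty$ for all $i$ and all continuous $f$ (on the relevant interval). Let $\alpha^k_i=i\,m_r/m_k$ ($0\le i\le m_k$), $\beta^k_j=j\,n_r/n_k$ ($0\le j\le n_k$), $\mu_i^{m_k}=\lambda^{m_r}_{\alpha^k_i}$, $\mu_j^{n_k}=\lambda^{n_r}_{\beta^k_j}$.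 It is known that the $\mu_i^{m_k}$, $0\le i\le m_k$, are linearly independent on $\Pi_{m_k}$ (and similarly for $n_k$); $D_0^{m_k},\dots,D_{m_k}^{m_k}$ is the basis of $\Pi_{m_k}$ with $\mu_i^{m_k}D_j^{m_k}=\delta_{ij}$, and $D_0^{n_k},\dots,D_{n_k}^{n_k}$ is the analogous basis of $\Pi_{n_k}$. $E_{m_k}^{m_r}$ is the $(m_r+1)\times(m_k+1)$ degree elevation matrix, with $B_j^{m_k}=\sum_{i}(E_{m_k}^{m_r})_{ij}B_i^{m_r}$; $E_{m_k}^{m_r}(\alpha^k,:)$ is its square submatrix with rows $\alpha^k_0,\dots,\alpha^k_{m_k}$ (invertible, by the linear independence above). Similarly $E_{n_k}^{n_r}(\beta^k,:)$. $\|\cdot\|_\infty$ of a matrix is the operator norm induced by the max norm. Projectors: $P_{m_k}f=\sum_{i=0}^{m_k}(\mu_i^{m_k}f)D_i^{m_k}$ on $C[a,b]$, $Q_{n_k}g=\sum_{j=0}^{n_k}(\mu_j^{n_k}g)D_j^{n_k}$ on $C[c,d]$. On $C([a,b]\times[c,d])$, $\mathbf P_{m_k}$ applies $P_{m_k}$ in the first variable and $\mathbf Q_{n_k}$ applies $Q_{n_k}$ in the second variable. By convention, for the index $-1$, $\mathbf P_{m_{-1}}=0$ and $\mathbf Q_{n_{-1}}=0$ (so that the complementary projectors $I-\mathbf P_{m_{-1}}$ and $I-\mathbf Q_{n_{-1}}$ are the identity). The Boolean sum is $A\oplus B=A+B-AB$. The discretely blended quasi-interpolant is the Boolean sum $\mathbf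 B_{\mathbf m,\mathbf n}=\bigoplus_{k=0}^r\mathbf P_{m_k}\mathbf Q_{n_{r-k}}$, equivalently (a known identity) $$\mathbf B_{\mathbf m,\mathbf n}=\sum_{k=0}^r\mathbf P_{m_k}\mathbf Q_{n_{r-k}}-\sum_{k=0}^{r-1}\mathbf P_{m_k}\mathbf Q_{n_{r-k-1}}.$$ $\|\cdot\|_{\infty,R}$ is the supremum norm on $R$; the norm of an operator on $C([a,b]\times[c,d])$ is the operator norm for the supremum norm. $F^{(i,j)}=\partial_x^i\partial_y^jF$; $C^{M,N}([a,b]\times[c,d])$ is the space of functions whose partial derivatives $F^{(i,j)}$, $0\le i\le M$, $0\le j\le N$, exist and are continuous.
   Formalization: The error bound is proved under the added assumption h ≤ 1; without it the claim fails, e.g. r=0, m_0=1, n_0=0, F=x² on [0,h]² with h>2 (error h²/4, bound h/2). The bound on the norm of the Boolean sum is proved for every h. *)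

(* Defs.v *)
From HB Require Import structures.
From mathcomp Require Import all_boot all_order all_algebra.
From mathcomp Require Import all_classical all_reals all_analysis.

Set Implicit Arguments.
Unset Strict Implicit.
Unset Printing Implicit Defensive.

Import Order.TTheory GRing.Theory Num.Theory.
Import numFieldNormedType.Exports.

Local Open Scope classical_set_scope.
Local Open Scope ring_scope.

(* Norms.  The supremum norm and the operator norm are extended-real-valued, so
   that no junk value can occur for an unbounded function or operator. *)

Definition supnorm (R : realType) (T : Type) (D : set T) (f : T -> R) : \bar R :=
  ereal_sup [set (`|f z|)%:E | z in D].

Definition rect (R : realType) (a b c d : R) : set (R * R) :=
  `[a, b]%classic `*` `[c, d]%classic.

Definition opnorm (R : realType) (a b c d : R)
    (A : (R * R -> R) -> (R * R -> R)) : \bar R :=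
  ereal_sup [set supnorm (rect a b c d) (A G) | G in
    [set G | {within rect a b c d, continuous G} /\
             (supnorm (rect a b c d) G <= 1)%E]].

(* The library norm of a column vector is its max norm. *)
Definition mx_opnorm (R : realType) (N : nat) (A : 'M[R]_N.+1) : R :=
  sup [set `|A *m v| | v in [set v : 'cV[R]_N.+1 | `|v| <= 1]].

Definition bernstein (R : realType) (a b : R) (N i : nat) (x : R) : R :=
  'C(N, i)%:R * ((b - x) / (b - a)) ^+ (N - i) * ((x - a) / (b - a)) ^+ i.

(* For N = 0 only i = 0 occurs, and 0 / 0 = 0. *)
Definition node (R : realType) (a b : R) (N i : nat) : R :=
  a + i%:R / N%:R * (b - a).

Definition collocation (R : realType) (a b : R) (N : nat) : 'M[R]_N.+1 :=
  \matrix_(i, j) bernstein a b N j (node a b N i).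

Definition lambda (R : realType) (a b : R) (N : nat) (i : 'I_N.+1)
    (f : R -> R) : R :=
  \sum_(s < N.+1) invmx (collocation a b N) i s * f (node a b N s).

Definition lambda_bound (R : realType) (a b : R) (N : nat) (C : R) : Prop :=
  forall (i : 'I_N.+1) (f : R -> R), {within `[a, b], continuous f} ->
    ((`|lambda a b i f|)%:E <= C%:E * supnorm `[a, b]%classic f)%E.

(* Below, N stands for m_k and M for m_r (or n_k and n_r).  When N %| M the
   index i * M %/ N is exact and at most M for i <= N, so inord is harmless;
   for N = M = 0 it is 0, because 0 %/ 0 = 0. *)
Definition alpha (M N : nat) (i : 'I_N.+1) : 'I_M.+1 := inord (i * M %/ N).

Definition mu (R : realType) (a b : R) (M N : nat) (i : 'I_N.+1)
    (f : R -> R) : R :=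
  lambda a b (alpha M i) f.

Definition is_poly_basis (R : realType) (N : nat)
    (D : {ffun 'I_N.+1 -> {poly R}}) : Prop :=
  (forall j, (size (D j) <= N.+1)%N) /\
  (forall p : {poly R}, (size p <= N.+1)%N ->
     exists! u : 'rV[R]_N.+1, p = \sum_j u 0 j *: D j).

Definition dual_basis (R : realType) (a b : R) (M N : nat) :
    {ffun 'I_N.+1 -> {poly R}} :=
  xget [ffun=> 0] [set D | is_poly_basis D /\
    forall i j : 'I_N.+1, mu a b M i (horner (D j)) = (i == j)%:R].

(* The degree elevation matrix from degree N to degree M is the same for every
   interval. *)
Definition elevation (R : realType) (M N : nat) : 'M[R]_(M.+1, N.+1) :=
  xget 0 [set E : 'M[R]_(M.+1, N.+1) | forall a b : R, a < b ->
    forall (j : 'I_N.+1) (x : R),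
      bernstein a b N j x = \sum_(i < M.+1) E i j * bernstein a b M i x].

Definition elevation_sub (R : realType) (M N : nat) : 'M[R]_N.+1 :=
  rowsub (@alpha M N) (elevation R M N).

Definition proj_const (R : realType) (C : nat -> R) (M N : nat) : R :=
  C M * N.+1%:R * mx_opnorm (invmx (elevation_sub R M N)).

Definition proj (R : realType) (a b : R) (M N : nat) (f : R -> R) : R -> R :=
  fun x => \sum_(i < N.+1) mu a b M i f * (dual_basis a b M N i).[x].

Definition projx (R : realType) (a b : R) (M N : nat) (F : R * R -> R) :
    R * R -> R :=
  fun z => proj a b M N (fun x => F (x, z.2)) z.1.

Definition projy (R : realType) (c d : R) (M N : nat) (F : R * R -> R) :
    R * R -> R :=
  fun z => proj c d M N (fun y => F (z.1, y)) z.2.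

Definition bool_sum (R : realType) (A B : (R * R -> R) -> (R * R -> R)) :
    (R * R -> R) -> (R * R -> R) :=
  fun F z => A F z + B F z - A (B F) z.

Definition op0 (R : realType) : (R * R -> R) -> (R * R -> R) := fun _ _ => 0.

Definition blend (R : realType) (a b c d : R) (r : nat) (m n : nat -> nat) :
    (R * R -> R) -> (R * R -> R) :=
  \big[@bool_sum R/@op0 R]_(k < r.+1)
    (projx a b (m r) (m k) \o projy c d (n r) (n (r - k)%N)).

(* Shifted indices, to accommodate the index -1: k >= 0 stands for the index
   k - 1.  Thus succ_deg m k is m_{k-1} + 1 (with m_{-1} = -1), and projx_prev,
   projy_prev are the projectors of index k - 1 (which vanish for k = 0). *)
Definition succ_deg (m : nat -> nat) (k : nat) : nat :=
  if k is k'.+1 then (m k').+1 else 0%N.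

Definition projx_prev (R : realType) (a b : R) (r : nat) (m : nat -> nat)
    (k : nat) : (R * R -> R) -> (R * R -> R) :=
  if k is k'.+1 then projx a b (m r) (m k') else @op0 R.

Definition projy_prev (R : realType) (c d : R) (r : nat) (n : nat -> nat)
    (l : nat) : (R * R -> R) -> (R * R -> R) :=
  if l is l'.+1 then projy c d (n r) (n l') else @op0 R.

(* Partial derivatives on the closed rectangle: difference quotients are taken
   inside the interval, hence they are one-sided at its end points. *)
Definition quotx (R : realType) (G : R * R -> R) (z : R * R) (t : R) : R :=
  (G (t, z.2) - G z) / (t - z.1).

Definition quoty (R : realType) (G : R * R -> R) (z : R * R) (t : R) : R :=
  (G (z.1, t) - G z) / (t - z.2).

Definition derivx (R : realType) (a b : R) (G : R * R -> R) (z : R * R) : R :=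
  lim (quotx G z t @[t --> within `[a, b]%classic (dnbhs z.1)]).

Definition derivy (R : realType) (c d : R) (G : R * R -> R) (z : R * R) : R :=
  lim (quoty G z t @[t --> within `[c, d]%classic (dnbhs z.2)]).

Definition partial (R : realType) (a b c d : R) (i j : nat)
    (F : R * R -> R) : R * R -> R :=
  iter i (derivx a b) (iter j (derivy c d) F).

Definition class_C (R : realType) (a b c d : R) (M N : nat)
    (F : R * R -> R) : Prop :=
  [/\ (forall j z, (j < N)%N -> rect a b c d z ->
         cvg (quoty (partial a b c d 0 j F) z t
                @[t --> within `[c, d]%classic (dnbhs z.2)])),
      (forall i j z, (i < M)%N -> (j <= N)%N -> rect a b c d z ->
         cvg (quotx (partial a b c d i j F) z t
                @[t --> within `[a, b]%classic (dnbhs z.1)])) &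
      (forall i j, (i <= M)%N -> (j <= N)%N ->
         {within rect a b c d, continuous (partial a b c d i j F)})].

(* K_{m_{k-1}, n_{l-1}}(F) *)
Definition K_const (R : realType) (a b c d : R) (r : nat) (m n : nat -> nat)
    (F : R * R -> R) (k l : nat) : \bar R :=
  ((1 + opnorm a b c d (bool_sum (projx_prev a b r m k) (projy_prev c d r n l)))
   * (supnorm (rect a b c d)
        (partial a b c d (succ_deg m k) (succ_deg n l) F)
      * ((2 ^+ (succ_deg m k + succ_deg n l)
          * (succ_deg m k)`!%:R * (succ_deg n l)`!%:R)^-1)%:E))%E.

Definition C_const (R : realType) (a b c d : R) (r : nat) (m n : nat -> nat)
    (F : R * R -> R) : \bar R :=
  (\sum_(k < r.+2) K_const a b c d r m n F k (r.+1 - k)%N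
   + \sum_(k < r.+1) K_const a b c d r m n F k.+1 (r - k).+1)%E.

(* m_{k-1} + n_{r-k} + 2 *)
Definition order_term (r : nat) (m n : nat -> nat) (k : nat) : nat :=
  (succ_deg m k + succ_deg n (r.+1 - k))%N.

Definition approx_order (r : nat) (m n : nat -> nat) : nat :=
  \big[minn/order_term r m n 0]_(k < r.+2) order_term r m n k.

(* Main.v *)
Require Import Defs.
From mathcomp Require Import all_boot all_order all_algebra.
From mathcomp Require Import all_classical all_reals all_analysis.
From mathcomp Require Import zify ring lra.

Set Implicit Arguments.
Unset Strict Implicit.
Unset Printing Implicit Defensive.

Import Order.TTheory GRing.Theory Num.Theory.
Import numFieldNormedType.Exports.

Local Open Scope classical_set_scope.
Local Open Scope ring_scope.

(** Write p_k and q_l for the univariate projectors of degrees m_k and n_l, with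
    p_(-1) = q_(-1) = 0, and P_k, Q_l for their actions in the first and in the
    second variable.

    Projectors.  The functionals lambda_i of degree M return the Bernstein
    coefficients of polynomials of degree at most M, because collocation at the
    nodes is unisolvent ([poly_lambda]).  Hence, on polynomials of degree at
    most N <= M, the functionals mu_i are given by the submatrix E(alpha,:) of
    the elevation matrix.  This submatrix is invertible: the i-th coefficient
    of degree M of a fixed polynomial of degree at most N is, up to a constant
    factor, a polynomial in i of degree at most N, so that it vanishes for all
    i as soon as it vanishes at the N + 1 distinct indices alpha_i
    ([elevation_sub_unit]).  So the dual basis exists, its elements have the
    columns of the inverse submatrix as Bernstein coefficients, and this gives
    the bound of p_k by the stated constant ([proj_le]), hence that of the
    Boolean sums ([opnorm_bool_sum_le]).  The projectors reproduce polynomials,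
    and divisibility of the degrees makes their functionals nested, so that
    p_k p_l = p_(min k l) ([level_proj_comp]).

    Algebra.  The operators P_k and Q_l commute, and composing Boolean sums
    from the right telescopes into the two sums of complements
    (I - P_(k-1)) (I - Q_(r-k)) and (I - P_k) (I - Q_(r-k)) ([blend_residual]).
    Each complement is F - (P (+) Q) F for a single Boolean sum.

    Analysis.  For projectors P and Q of degrees m and n, let X and Y be Lagrange
    interpolation with m + 1 and n + 1 nodes in the first and second variable,
    and U = (I - Y) (I - X) F.  As P X = X and Q Y = Y,
    F - (P (+) Q) F = U - (P (+) Q) U, of norm at most
    (1 + ||P (+) Q||) ||U|| ([bool_sum_reproduce]).  If the nodes are symmetric
    about the midpoint of an interval of length h, pairing each node with its
    mirror image bounds the node polynomial by (h/2)^(m+1) ([prod_sym_node]),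
    and the classical error formula, obtained from iterated use of Rolle's
    theorem and applied in each variable in turn, bounds ||U||
    ([residual_le]).  Interpolation only uses values of F, so the derivatives
    are taken in the prescribed order and no exchange of partial derivatives
    is needed.  Finally h <= 1 allows every power of h to be replaced by the
    one of lowest exponent. *)

(** * Bernstein polynomials and collocation *)

(** The Bernstein polynomial [bernstein a b N i] as a formal polynomial. *)
Definition bernp (R : realType) (a b : R) (N i : nat) : {poly R} :=
  'C(N, i)%:R *: (((b - a)^-1 *: (b%:P - 'X)) ^+ (N - i)
                  * ((b - a)^-1 *: ('X - a%:P)) ^+ i).

Lemma horner_bernp (R : realType) (a b : R) N i x :
  (bernp a b N i).[x] = bernstein a b N i x.
Proof.
rewrite /bernp /bernstein !hornerE.
by rewrite ![(b - a)^-1 * _]mulrC.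
Qed.

Lemma size_bernp (R : realType) (a b : R) N i :
  (i <= N)%N -> (size (bernp a b N i) <= N.+1)%N.
Proof.
move=> iN; have lin (p : {poly R}) e : (size p <= 2)%N -> (size (p ^+ e) <= e.+1)%N.
  move=> sp; apply: leq_trans (size_poly_exp_leq _ _) _.
  by rewrite ltnS -[leqRHS]mul1n leq_mul2r; case: (size p) sp => [|[|[]]] //; rewrite orbT.
have s1 : (size ((b - a)^-1 *: (b%:P - 'X)) <= 2)%N.
  rewrite -[b%:P - _]opprB scalerN size_polyN.
  by rewrite (leq_trans (size_scale_leq _ _)) // size_XsubC.
have s2 : (size ((b - a)^-1 *: ('X - a%:P)) <= 2)%N.
  by rewrite (leq_trans (size_scale_leq _ _)) // size_XsubC.
apply: leq_trans (size_scale_leq _ _) _; apply: leq_trans (size_polyMleq _ _) _.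
apply: (@leq_trans ((N - i).+1 + i.+1).-1); last by rewrite addSn addnS /= subnK.
by rewrite -!subn1 leq_sub2r // leq_add // lin.
Qed.

Lemma size_sum_scale_le (R : realType) N k (c : 'I_k -> R) (p : 'I_k -> {poly R}) :
  (forall j, (size (p j) <= N)%N) -> (size (\sum_j c j *: p j)%R <= N)%N.
Proof.
move=> sp; apply: (big_ind (fun q : {poly R} => (size q <= N)%N)) => [|q q' sq sq'|j _].
- by rewrite size_poly0.
- by rewrite (leq_trans (size_polyD _ _)) // geq_max sq.
- by rewrite (leq_trans (size_scale_leq _ _)).
Qed.

Lemma poly_eq0_roots (R : realType) (N : nat) (t : 'I_N -> R) (p : {poly R}) :
  injective t -> (size p <= N)%N -> (forall i, p.[t i] = 0) -> p = 0.
Proof.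
move=> tI sp pt; apply: (@roots_geq_poly_eq0 _ p (codom t)).
- by apply/allP => x /codomP [i ->]; apply/rootP.
- by rewrite map_inj_uniq ?enum_uniq.
- by rewrite size_codom card_ord.
Qed.

(** Linear independence of the Bernstein polynomials.  At the points dividing
    [a, b] in the ratio i : 1, a combination of Bernstein polynomials equals, up
    to the factor (1 + i)^N, a polynomial in i with coefficients c_j C(N, j). *)
Lemma bernstein_free (R : realType) (a b : R) N (c : 'I_N.+1 -> R) : a < b ->
  (forall x, \sum_j c j * bernstein a b N j x = 0) -> forall j, c j = 0.
Proof.
move=> ab c0.
have ba0 : b - a != 0 by rewrite subr_eq0 gt_eqF.
pose q : {poly R} := \poly_(j < N.+1) (c (inord j) * 'C(N, j)%:R).
have q0 : q = 0.
  apply: (@poly_eq0_roots _ N.+1 (fun i => i%:R)) => [i j /eqP||i].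
  - by rewrite eqr_nat => /eqP/val_inj.
  - exact: size_poly.
  have i0 : (1 + i%:R : R) != 0 by rewrite -(natrD _ 1) pnatr_eq0.
  pose x : R := a + (b - a) * (i%:R / (1 + i%:R)).
  have -> : q.[i%:R] = (1 + i%:R) ^+ N * \sum_j c j * bernstein a b N j x.
    rewrite horner_poly mulr_sumr; apply: eq_bigr => j _; rewrite inord_val /bernstein.
    have -> : (b - x) / (b - a) = (1 + i%:R)^-1 by rewrite /x; field; rewrite ?ba0 ?i0.
    have -> : (x - a) / (b - a) = i%:R * (1 + i%:R)^-1 by rewrite /x; field; rewrite ?ba0 ?i0.
    have -> : (1 + i%:R : R) ^+ N = (1 + i%:R) ^+ (N - j) * (1 + i%:R) ^+ j.
      by rewrite -exprD subnK ?leq_ord.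
    rewrite exprMn.
    rewrite !exprVn; field; by rewrite !expf_neq0.
  by rewrite c0 mulr0.
move=> j; have /(congr1 (fun p : {poly R} => p`_j)) := q0.
rewrite coef_poly ltn_ord inord_val coef0 => /eqP.
by rewrite mulf_eq0 pnatr_eq0 -leqn0 leqNgt bin_gt0 leq_ord orbF => /eqP.
Qed.

Lemma bernstein_inj (R : realType) (a b : R) N (c e : 'I_N.+1 -> R) : a < b ->
  (forall x, \sum_j c j * bernstein a b N j x = \sum_j e j * bernstein a b N j x) ->
  forall j, c j = e j.
Proof.
move=> ab ce j; apply/eqP; rewrite -subr_eq0; apply/eqP.
apply: (@bernstein_free _ a b N (fun j => c j - e j) ab) => x.
under eq_bigr do rewrite mulrBl.
by rewrite sumrB ce subrr.
Qed.

Lemma node_inj (R : realType) (a b : R) N : a < b ->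
  injective (fun i : 'I_N.+1 => node a b N i).
Proof.
move=> ab; case: N => [|N] i j; first by rewrite !ord1.
move=> /addrI /(mulIf _); rewrite subr_eq0 gt_eqF // => /(_ isT).
move=> /(mulIf _); rewrite invr_eq0 pnatr_eq0 => /(_ isT) /eqP.
by rewrite eqr_nat => /eqP/val_inj.
Qed.

Lemma node_itv (R : realType) (a b : R) N (i : 'I_N.+1) : a < b ->
  node a b N i \in `[a, b].
Proof.
move=> ab; have ba : 0 < b - a by rewrite subr_gt0.
have le1 : (i%:R / N%:R : R) <= 1.
  case: N i => [|N] i; first by rewrite invr0 mulr0.
  by rewrite ler_pdivrMr ?ltr0n // mul1r ler_nat -ltnS.
have ge0 : 0 <= (i%:R / N%:R : R) by rewrite divr_ge0.
rewrite in_itv /= /node; apply/andP; split; first by rewrite lerDl mulr_ge0 // ltW.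
by rewrite -lerBrDl ler_piMl // ltW.
Qed.

Lemma mulmx_eq0_unit (R : realType) N (A : 'M[R]_N) :
  (forall v : 'cV_N, A *m v = 0 -> v = 0) -> A \in unitmx.
Proof.
move=> Av; rewrite -unitmx_tr -row_free_unit -kermx_eq0; apply/eqP/row_matrixP => i.
rewrite row0; apply: trmx_inj; rewrite trmx0; apply: Av.
by rewrite -{1}[A]trmxK -trmx_mul -row_mul mulmx_ker row0 trmx0.
Qed.

Lemma size_sum_bernp (R : realType) (a b : R) N (c : 'I_N.+1 -> R) :
  (size (\sum_j c j *: bernp a b N j)%R <= N.+1)%N.
Proof. by apply: size_sum_scale_le => j; rewrite size_bernp // -ltnS. Qed.

Lemma horner_sum_bernp (R : realType) (a b : R) N (c : 'I_N.+1 -> R) x :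
  (\sum_j c j *: bernp a b N j).[x] = \sum_j c j * bernstein a b N j x.
Proof.
by rewrite horner_sum; apply: eq_bigr => j _; rewrite hornerZ horner_bernp.
Qed.

Lemma collocation_unit (R : realType) (a b : R) N : a < b ->
  collocation a b N \in unitmx.
Proof.
move=> ab; apply: mulmx_eq0_unit => v /colP Tv.
have p0 : \sum_j v j 0 *: bernp a b N j = 0.
  apply: (poly_eq0_roots (@node_inj _ _ _ _ ab)); first exact: size_sum_bernp.
  move=> i; rewrite horner_sum_bernp; have := Tv i; rewrite !mxE => Ti; rewrite -[RHS]Ti.
  by apply: eq_bigr => j _; rewrite !mxE mulrC.
apply/colP => j; rewrite mxE; move: j.
apply: (@bernstein_free _ a b N (fun j => v j 0) ab) => x.
by rewrite -horner_sum_bernp p0 horner0.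
Qed.

Lemma lambda_bernstein (R : realType) (a b : R) N (c : 'I_N.+1 -> R) i : a < b ->
  lambda a b i (fun x => \sum_j c j * bernstein a b N j x) = c i.
Proof.
move=> ab; rewrite /lambda.
transitivity ((invmx (collocation a b N) *m (collocation a b N *m \col_j c j)) i 0).
  rewrite [in RHS]mxE; apply: eq_bigr => s _; rewrite [in RHS]mxE; congr (_ * _).
  by apply: eq_bigr => j _; rewrite !mxE mulrC.
by rewrite mulKmx ?collocation_unit // mxE.
Qed.

(** The functionals [lambda] compute Bernstein coefficients. *)
Lemma poly_lambda (R : realType) (a b : R) N (p : {poly R}) : a < b ->
  (size p <= N.+1)%N ->
  forall x, p.[x] = \sum_(j < N.+1) lambda a b j (horner p) * bernstein a b N j x.
Proof.
move=> ab sp x; rewrite -horner_sum_bernp; congr (_.[x]); apply/eqP; rewrite -subr_eq0.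
apply/eqP/(poly_eq0_roots (@node_inj _ _ _ N ab)).
  by rewrite (leq_trans (size_polyD _ _)) // geq_max sp size_polyN size_sum_bernp.
move=> i; rewrite hornerD hornerN horner_sum_bernp.
pose v : 'cV[R]_N.+1 := \col_s p.[node a b N s].
suff -> : \sum_(j < N.+1) lambda a b j (horner p) * bernstein a b N j (node a b N i)
        = (collocation a b N *m (invmx (collocation a b N) *m v)) i 0.
  by rewrite mulKVmx ?collocation_unit // mxE subrr.
rewrite mxE; apply: eq_bigr => j _; rewrite !mxE mulrC; congr (_ * _).
by apply: eq_bigr => s _; rewrite !mxE.
Qed.

(** * Degree elevation *)

(** The (i, j) entry of the elevation matrix, written with falling factorials so
    that it is visibly polynomial in i. *)
Definition elev_coef (R : realType) (M N i j : nat) : R :=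
  'C(N, j)%:R * ((i ^_ j)%:R * ((M - i) ^_ (N - j))%:R) / (M ^_ N)%:R.

(** Both sides are M! divided by the same two factorials. *)
Lemma bin_elev (M N i j : nat) : (j <= N)%N -> (N <= M)%N -> (j <= i)%N -> (i <= M - N + j)%N ->
  ('C(M, i) * (i ^_ j * (M - i) ^_ (N - j)) = 'C(M - N, i - j) * M ^_ N)%N.
Proof.
move=> jN NM ji iM.
have iM' : (i <= M)%N by lia.
have le2 : (N - j <= M - i)%N by lia.
have pos : (0 < (i - j)`! * (M - i - (N - j))`!)%N by rewrite muln_gt0 !fact_gt0.
apply/eqP; rewrite -(eqn_pmul2r pos).
rewrite [X in (X == _)%N](_ : _ = M`!)%N; last first.
  rewrite -(bin_fact iM') -(ffact_fact ji) -(ffact_fact le2).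
  by move: (_`!) (_`!) => u v; ring.
rewrite [X in (_ == X)%N](_ : _ = M`!)%N //.
rewrite -(ffact_fact NM) -(@bin_fact (M - N) (i - j)); last by lia.
have -> : (M - i - (N - j) = M - N - (i - j))%N by lia.
by move: (_`!) (_`!) => u v; ring.
Qed.

(** Degree elevation: multiply by the binomial expansion of
    ((b - x)/(b - a) + (x - a)/(b - a))^(M - N) = 1. *)
Lemma bernstein_elev (R : realType) (a b : R) M N j x : a < b ->
  (j <= N)%N -> (N <= M)%N ->
  bernstein a b N j x = \sum_(i < M.+1) elev_coef R M N i j * bernstein a b M i x.
Proof.
move=> ab jN NM; rewrite /bernstein.
set s := (b - x) / (b - a); set t := (x - a) / (b - a).
have st : s + t = 1 by rewrite /s /t; field; rewrite subr_eq0 gt_eqF.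
pose f i : R := elev_coef R M N i j * ('C(M, i)%:R * s ^+ (M - i) * t ^+ i).
transitivity (\sum_(0 <= i < M.+1) f i); last by rewrite big_mkord.
have jM : (j <= M - N + j)%N by rewrite leq_addl.
have jM2 : (M - N + j <= M)%N by lia.
rewrite (@big_cat_nat _ _ _ (M - N + j).+1) ?ltnS //= (@big_cat_nat _ _ _ j) ?ltnS ?(leqW jM) //=.
rewrite [X in X + _ + _]big_nat_cond [X in X + _ + _]big1 ?add0r; last first.
  by move=> i /andP[/andP[_ ij] _]; rewrite /f /elev_coef ffact_small // mul0r mulr0 !mul0r.
rewrite [X in _ + X]big_nat_cond [X in _ + X]big1 ?addr0; last first.
  move=> i /andP[/andP[ij1 ij2] _]; rewrite /f /elev_coef.
  rewrite [((M - i) ^_ _)%N]ffact_small ?mulr0 ?mul0r //.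
  by lia.
have -> : \sum_(j <= i < (M - N + j).+1) f i = \sum_(i < (M - N).+1) f (i + j)%N.
  have := big_addn 0 (M - N + j).+1 j xpredT f; rewrite add0n => ->.
  by rewrite subSn ?leq_addl // addnK big_mkord.
have e1 : 1 = \sum_(i < (M - N).+1) s ^+ (M - N - i) * t ^+ i *+ 'C(M - N, i).
  by rewrite -exprDn st expr1n.
rewrite -[LHS]mulr1 [X in _ * X = _]e1 mulr_sumr.
apply: eq_bigr => i _; rewrite /f /elev_coef.
have iM := leq_ord i.
have := @bin_elev M N (i + j)%N j jN NM; rewrite leq_addl leq_add2r => /(_ isT iM).
rewrite addnK => /(congr1 (fun k => k%:R : R)); rewrite !natrM => E.
have M0 : (M ^_ N)%:R != 0 :> R by rewrite pnatr_eq0 -lt0n ffact_gt0.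
have -> : s ^+ (M - (i + j)) = s ^+ (N - j) * s ^+ (M - N - i).
  by rewrite -exprD; congr (_ ^+ _); lia.
rewrite -[_ *+ 'C(M - N, i)]mulr_natl exprD.
set u := 'C(M, _)%:R in E *; set v := (_ ^_ j)%:R in E *.
set w := (_ ^_ (N - j))%:R in E *.
have E' : 'C(M - N, i)%:R = u * (v * w) / (M ^_ N)%:R by rewrite E mulfK.
rewrite E'; by field.
Qed.

Lemma elevationP (R : realType) (M N : nat) (a b : R) (j : 'I_N.+1) x :
  (N <= M)%N -> a < b ->
  bernstein a b N j x = \sum_(i < M.+1) elevation R M N i j * bernstein a b M i x.
Proof.
move=> NM ab; rewrite /elevation; case: xgetP => [E _ EP|/(_ (\matrix_(i, j) elev_coef R M N i j))].
  exact: EP.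
case=> a' b' ab' j' x'; rewrite (@bernstein_elev _ a' b' M N) ?leq_ord //.
by apply: eq_bigr => i _; rewrite mxE.
Qed.

Lemma elevationE (R : realType) (M N : nat) (i : 'I_M.+1) (j : 'I_N.+1) :
  (N <= M)%N -> elevation R M N i j = elev_coef R M N i j.
Proof.
move=> NM; move: i; apply: (@bernstein_inj _ 0 1 M) => // x.
by rewrite -elevationP // -bernstein_elev // leq_ord.
Qed.

Lemma alphaE (M N : nat) (i : 'I_N.+1) : (N %| M)%N -> (N <= M)%N ->
  alpha M i = (i * (M %/ N))%N :> nat.
Proof.
move=> NM leNM; rewrite /alpha muln_divA // inordK // ltnS -muln_divA //.
case: N i NM {leNM} => [|N] i NM; first by rewrite divn0 muln0.
by rewrite -[leqRHS](divnK NM) mulnC leq_mul2l leq_ord orbT.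
Qed.

Lemma alpha_inj (M N : nat) : (N %| M)%N -> (N <= M)%N -> injective (@alpha M N).
Proof.
move=> NM leNM i j /(congr1 val); rewrite /= !alphaE // => /eqP.
case: N i j NM leNM => [|N] i j NM leNM; first by rewrite !ord1.
by rewrite eqn_mul2r gtn_eqF ?divn_gt0 // => /eqP/val_inj.
Qed.

(** The index sets of the functionals of the various levels are nested. *)
Lemma alpha_comp (M N2 N1 : nat) (i : 'I_N1.+1) :
  (N1 %| N2)%N -> (N1 <= N2)%N -> (N2 %| M)%N -> (N2 <= M)%N ->
  alpha M (alpha N2 i) = alpha M i.
Proof.
move=> d1 l1 d2 l2; apply: val_inj; rewrite /= !alphaE ?(dvdn_trans d1) ?(leq_trans l1) //.
rewrite -mulnA; case: N1 i d1 l1 => [|N1] i d1 l1; first by rewrite !ord1.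
have N2p : (0 < N2)%N by rewrite (leq_trans _ l1).
by congr (_ * _)%N; rewrite mulnC muln_divA // divnK.
Qed.

Lemma size_prod_linear (R : realType) (k : nat) (p : nat -> {poly R}) :
  (forall i, (size (p i) <= 2)%N) -> (size (\prod_(i < k) p i)%R <= k.+1)%N.
Proof.
move=> sp; elim: k => [|k IH]; first by rewrite big_ord0 size_poly1.
rewrite big_ord_recr /=; apply: leq_trans (size_polyMleq _ _) _.
by move: IH (sp k); move: (size _) (size _) => u v; lia.
Qed.

Lemma prod_ffact (R : realType) (i j : nat) :
  \prod_(l < j) (i%:R - l%:R) = (i ^_ j)%:R :> R.
Proof.
elim: j => [|j IH]; first by rewrite big_ord0.
rewrite big_ord_recr /= IH ffactnSr natrM.
by have [ji|ij] := leqP j i; [rewrite natrB | rewrite (ffact_small ij) !mul0r].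
Qed.

(** The rows alpha of the elevation matrix form an invertible matrix.  If v is in
    the kernel, the polynomial G below, of degree at most N, vanishes at the N + 1
    indices alpha_i, hence at all of 0, ..., M; so the polynomial with Bernstein
    coefficients v has all its coefficients of degree M equal to 0. *)
Lemma elevation_sub_unit (R : realType) (M N : nat) : (N %| M)%N -> (N <= M)%N ->
  elevation_sub R M N \in unitmx.
Proof.
move=> NM leNM; apply: mulmx_eq0_unit => v /colP Sv.
pose G : {poly R} := \sum_(j < N.+1) (v j 0 * 'C(N, j)%:R) *:
  (\prod_(l < j) ('X - l%:R%:P) * \prod_(l < N - j) ((M%:R - l%:R)%:P - 'X)).
have sG : (size G <= N.+1)%N.
  apply: size_sum_scale_le => j; rewrite (leq_trans (size_polyMleq _ _)) //.
  have := @size_prod_linear R j (fun l => 'X - l%:R%:P).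
  have := @size_prod_linear R (N - j) (fun l => (M%:R - l%:R)%:P - 'X).
  move=> /(_ _)/wrap[l|s1]; first by rewrite -opprB size_polyN size_XsubC.
  move=> /(_ _)/wrap[l|s2]; first by rewrite size_XsubC.
  by have := leq_ord j; move: s1 s2; move: (size _) (size _) => d1 d2; lia.
have GE (i : nat) : (i <= M)%N ->
    G.[i%:R] = (M ^_ N)%:R * \sum_(j < N.+1) elev_coef R M N i j * v j 0.
  move=> iM; rewrite horner_sum mulr_sumr; apply: eq_bigr => j _.
  rewrite hornerZ hornerM !horner_prod /elev_coef.
  under eq_bigr do rewrite hornerXsubC.
  have -> : \prod_(l < N - j) ((M%:R - l%:R)%:P - 'X).[i%:R] = ((M - i) ^_ (N - j))%:R :> R.
    rewrite -prod_ffact; apply: eq_bigr => l _.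
    by rewrite hornerD hornerN hornerC hornerX addrAC natrB.
  rewrite prod_ffact; field.
  by rewrite pnatr_eq0 -lt0n ffact_gt0.
have G0 : G = 0.
  apply: (@poly_eq0_roots _ _ (fun i : 'I_N.+1 => (alpha M i)%:R : R)) => // [i j /eqP|i].
    by rewrite eqr_nat => /eqP/val_inj/(alpha_inj NM leNM).
  rewrite GE ?leq_ord //; have := Sv i; rewrite !mxE => Svi.
  rewrite -[X in _ * X](_ : 0 = _) ?mulr0 // -[LHS]Svi.
  by apply: eq_bigr => j _; rewrite mxE elevationE.
apply/colP => j; rewrite mxE; move: j.
apply: (@bernstein_free _ 0 1 N (fun j => v j 0)) => // x.
under eq_bigr do rewrite (@bernstein_elev _ _ _ M) ?leq_ord // mulr_sumr.
rewrite exchange_big big1 //= => i _.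
have := GE i (leq_ord i); rewrite G0 horner0 => /esym/eqP.
rewrite mulf_eq0 pnatr_eq0 -leqn0 leqNgt ffact_gt0 leNM /= => /eqP Ei.
transitivity ((\sum_(j < N.+1) elev_coef R M N i j * v j 0) * bernstein 0 1 M i x).
  by rewrite mulr_suml; apply: eq_bigr => j _; rewrite mulrCA mulrA.
by rewrite Ei mul0r.
Qed.

(** * The dual basis and the projectors *)

Lemma lambda_sum (R : realType) (a b : R) N (i : 'I_N.+1) k (u : 'I_k -> R)
    (f : 'I_k -> R -> R) :
  lambda a b i (fun x => \sum_j u j * f j x) = \sum_j u j * lambda a b i (f j).
Proof.
rewrite /lambda; under eq_bigr do rewrite mulr_sumr.
rewrite exchange_big; apply: eq_bigr => j _; rewrite mulr_sumr.
by apply: eq_bigr => s _; rewrite mulrCA.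
Qed.

(** On polynomials of degree at most N the functionals mu are given by the
    submatrix of the elevation matrix, in the Bernstein basis. *)
Lemma mu_bernstein (R : realType) (a b : R) (M N : nat) (c : 'I_N.+1 -> R) i :
  a < b -> (N <= M)%N ->
  mu a b M i (fun x => \sum_j c j * bernstein a b N j x)
  = (elevation_sub R M N *m \col_j c j) i 0.
Proof.
move=> ab NM; rewrite /mu lambda_sum !mxE; apply: eq_bigr => j _; rewrite !mxE mulrC.
congr (_ * _); under [X in lambda _ _ _ X]eq_fun do rewrite (@elevationP _ M) //.
exact: lambda_bernstein.
Qed.

Lemma mu_poly (R : realType) (a b : R) (M N : nat) (p : {poly R}) (i : 'I_N.+1) :
  a < b -> (N <= M)%N -> (size p <= N.+1)%N ->
  mu a b M i (horner p)
  = (elevation_sub R M N *m \col_(j < N.+1) lambda a b j (horner p)) i 0.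
Proof.
move=> ab NM sp; rewrite -(@mu_bernstein _ a b) //; congr (mu _ _ _ _ _).
by apply/funext => x; apply: poly_lambda.
Qed.

(** Conversely the Bernstein coefficients are recovered from the values of the
    functionals mu by the inverse of that submatrix. *)
Lemma lambda_mu (R : realType) (a b : R) (M N : nat) (p : {poly R}) :
  a < b -> (N %| M)%N -> (N <= M)%N -> (size p <= N.+1)%N ->
  forall k : 'I_N.+1, lambda a b k (horner p)
  = \sum_i invmx (elevation_sub R M N) k i * mu a b M i (horner p).
Proof.
move=> ab NM leNM sp k; have U := elevation_sub_unit R NM leNM.
pose c : 'cV[R]_N.+1 := \col_(j < N.+1) lambda a b j (horner p).
have -> : lambda a b k (horner p) = (invmx (elevation_sub R M N) *m (elevation_sub R M N *m c)) k 0.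
  by rewrite mulKmx // mxE.
by rewrite mxE; apply: eq_bigr => i _; rewrite mu_poly.
Qed.

(** The dual basis exists, so [dual_basis] is not its default value.  The witness
    takes the columns of the inverse submatrix as Bernstein coefficients. *)
Lemma dual_basisP (R : realType) (a b : R) (M N : nat) :
  a < b -> (N %| M)%N -> (N <= M)%N ->
  is_poly_basis (dual_basis a b M N) /\
  forall i j : 'I_N.+1, mu a b M i (horner (dual_basis a b M N j)) = (i == j)%:R.
Proof.
move=> ab NM leNM; have U := elevation_sub_unit R NM leNM.
rewrite /dual_basis; case: xgetP => [D _ //|].
move=> /(_ [ffun j => \sum_k invmx (elevation_sub R M N) k j *: bernp a b N k]) nD.
exfalso; apply: nD => /=.
set D := (X in is_poly_basis X).
have sD j : (size (D j) <= N.+1)%N by rewrite ffunE size_sum_bernp.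
have muD i j : mu a b M i (horner (D j)) = (i == j)%:R.
  have -> : horner (D j) = fun x => \sum_k invmx (elevation_sub R M N) k j * bernstein a b N k x.
    by apply/funext => x; rewrite ffunE horner_sum_bernp.
  rewrite mu_bernstein // //.
  transitivity ((1%:M : 'M[R]_N.+1) i j); last by rewrite mxE.
  by rewrite -(mulmxV U) !mxE; apply: eq_bigr => k _; rewrite ?mxE.
split=> //; split=> // p sp.
have muS (u : 'rV[R]_N.+1) i : mu a b M i (horner (\sum_j u 0 j *: D j)) = u 0 i.
  have -> : horner (\sum_j u 0 j *: D j) = fun x => \sum_j u 0 j * (D j).[x].
    by apply/funext => x; rewrite horner_sum; apply: eq_bigr => j _; rewrite hornerZ.
  rewrite /mu lambda_sum (bigD1 i) //= -[lambda _ _ _ _]/(mu a b M i (horner (D i))).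
  rewrite muD eqxx mulr1 big1 ?addr0 // => j ji.
  by rewrite -[lambda _ _ _ _]/(mu a b M i (horner (D j))) muD eq_sym (negbTE ji) mulr0.
exists (\row_i mu a b M i (horner p)); split; last first.
  by move=> u pE; apply/rowP => i; rewrite mxE pE muS.
set q := \sum_j _.
have sq : (size q <= N.+1)%N by exact: size_sum_scale_le.
have pq x : p.[x] = q.[x].
  rewrite (poly_lambda ab sp) (poly_lambda ab sq); apply: eq_bigr => j _.
  rewrite !(lambda_mu ab NM leNM) //; congr (_ * _); apply: eq_bigr => i _.
  by rewrite muS mxE.
apply/eqP; rewrite -subr_eq0; apply/eqP.
apply: (@poly_eq0_roots _ _ _ _ (@node_inj _ a b N ab)) => [|i].
  by rewrite (leq_trans (size_polyD _ _)) // geq_max sp size_polyN.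
by rewrite hornerD hornerN pq subrr.
Qed.

Lemma mu_sum (R : realType) (a b : R) M N (i : 'I_N.+1) k (u : 'I_k -> R)
    (p : 'I_k -> {poly R}) :
  mu a b M i (horner (\sum_j u j *: p j)) = \sum_j u j * mu a b M i (horner (p j)).
Proof.
rewrite /mu -lambda_sum; congr (lambda _ _ _ _); apply/funext => x.
by rewrite horner_sum; apply: eq_bigr => j _; rewrite hornerZ.
Qed.

Lemma projE (R : realType) (a b : R) M N f :
  Defs.proj a b M N f = horner (\sum_i mu a b M i f *: dual_basis a b M N i).
Proof.
by apply/funext => x; rewrite horner_sum; apply: eq_bigr => j _; rewrite hornerZ.
Qed.

Lemma size_proj (R : realType) (a b : R) M N f :
  a < b -> (N %| M)%N -> (N <= M)%N ->
  (size (\sum_i mu a b M i f *: dual_basis a b M N i)%R <= N.+1)%N.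
Proof.
move=> ab NM leNM; have [[sD _] _] := dual_basisP ab NM leNM.
exact: size_sum_scale_le.
Qed.

Lemma mu_proj (R : realType) (a b : R) M N f (i : 'I_N.+1) :
  a < b -> (N %| M)%N -> (N <= M)%N ->
  mu a b M i (Defs.proj a b M N f) = mu a b M i f.
Proof.
move=> ab NM leNM; have [_ muD] := dual_basisP ab NM leNM.
rewrite projE mu_sum (bigD1 i) //= muD eqxx mulr1 big1 ?addr0 // => j ji.
by rewrite muD eq_sym (negbTE ji) mulr0.
Qed.

Lemma proj_poly (R : realType) (a b : R) M N (p : {poly R}) :
  a < b -> (N %| M)%N -> (N <= M)%N -> (size p <= N.+1)%N ->
  Defs.proj a b M N (horner p) = horner p.
Proof.
move=> ab NM leNM sp; have [[_ /(_ p sp) [u [-> _]]] muD] := dual_basisP ab NM leNM.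
rewrite projE; congr horner; apply: eq_bigr => i _; congr (_ *: _).
rewrite (mu_sum a b M i (fun j => u 0 j)) (bigD1 i) //= muD eqxx mulr1 big1 ?addr0 // => j ji.
by rewrite muD eq_sym (negbTE ji) mulr0.
Qed.

Lemma proj_proj_ge (R : realType) (a b : R) M N1 N2 f :
  a < b -> (N1 <= N2)%N -> (N1 %| M)%N -> (N2 %| M)%N -> (N2 <= M)%N ->
  Defs.proj a b M N2 (Defs.proj a b M N1 f) = Defs.proj a b M N1 f.
Proof.
move=> ab N12 d1 d2 l2; rewrite [Defs.proj a b M N1 f]projE proj_poly //.
by rewrite (leq_trans (size_proj _ _ _ _)) // (leq_trans N12).
Qed.

(** The composition rule that needs N1 to divide N2, and not only M: the
    functionals of the lower level are among those of the higher level. *)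
Lemma proj_proj_le (R : realType) (a b : R) M N1 N2 f :
  a < b -> (N1 <= N2)%N -> (N1 %| N2)%N -> (N2 %| M)%N -> (N2 <= M)%N ->
  Defs.proj a b M N1 (Defs.proj a b M N2 f) = Defs.proj a b M N1 f.
Proof.
move=> ab N12 d1 d2 l2; apply/funext => x; apply: eq_bigr => i _; congr (_ * _).
have mu12 g : mu a b M i g = mu a b M (alpha N2 i) g by rewrite /mu alpha_comp.
by rewrite !mu12 mu_proj.
Qed.

(** * Bounds for the functionals and the projectors *)

Lemma supnorm_le (R : realType) (T : Type) (D : set T) (f : T -> R) (s : R) :
  (forall z, D z -> `|f z| <= s) -> (supnorm D f <= s%:E)%E.
Proof.
by move=> fs; apply: ge_ereal_sup => _ [z Dz <-]; rewrite lee_fin; apply: fs.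
Qed.

Lemma supnorm_ge (R : realType) (T : Type) (D : set T) (f : T -> R) z :
  D z -> (`|f z|%:E <= supnorm D f)%E.
Proof. by move=> Dz; apply: ereal_sup_ubound; exists z. Qed.

(** A bounding constant is nonnegative: test it on the constant function 1. *)
Lemma lambda_bound_ge0 (R : realType) (a b : R) N C : a < b ->
  lambda_bound a b N C -> 0 <= C.
Proof.
move=> ab /(_ ord0 (fun=> 1)) H.
have s1 : supnorm `[a, b]%classic (fun=> 1 : R) = 1%:E.
  apply/eqP; rewrite eq_le; apply/andP; split.
    by apply: supnorm_le => z _; rewrite normr1.
  rewrite -{1}[1]normr1; apply: (@supnorm_ge _ _ _ (fun=> 1) a).
  by rewrite /= in_itv /= lexx ltW.
move: H; rewrite s1 mule1 lee_fin => H; apply: le_trans (H _) => //.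
by apply: continuous_subspaceT => x; apply: cst_continuous.
Qed.

Lemma lambda_le (R : realType) (a b : R) N C (i : 'I_N.+1) f s : a < b ->
  lambda_bound a b N C -> {within `[a, b], continuous f} ->
  (forall x, x \in `[a, b] -> `|f x| <= s) -> `|lambda a b i f| <= C * s.
Proof.
move=> ab CP cf fs; rewrite -lee_fin; apply: le_trans (CP i f cf) _.
rewrite EFinM lee_wpmul2l ?lee_fin ?(lambda_bound_ge0 ab CP) //.
by apply: supnorm_le.
Qed.

Lemma mx_norm_entry (R : realType) p q (A : 'M[R]_(p.+1, q.+1)) i j : `|A i j| <= `|A|.
Proof.
rewrite [leRHS]/Num.Def.normr /= mx_normrE.
by apply: (le_bigmax _ (fun ij : 'I_p.+1 * 'I_q.+1 => `|A ij.1 ij.2|) (i, j)).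
Qed.

Lemma mx_norm_le (R : realType) p q (A : 'M[R]_(p.+1, q.+1)) s :
  0 <= s -> (forall i j, `|A i j| <= s) -> `|A| <= s.
Proof.
move=> s0 As; rewrite [leLHS]/Num.Def.normr /= mx_normrE.
by apply: bigmax_le.
Qed.

(** Every entry is bounded by the operator norm: apply the matrix to a basis
    vector.  The set under the supremum is bounded by the sum of the absolute values of
    all entries. *)
Lemma mx_opnorm_ge (R : realType) N (A : 'M[R]_N.+1) i j : `|A i j| <= mx_opnorm A.
Proof.
apply: (@le_trans _ _ `|A *m delta_mx j (0 : 'I_1)|).
  rewrite -colE (le_trans _ (mx_norm_entry (col j A) i 0)) //.
  by rewrite mxE.
have ub : has_ubound [set `|A *m v| | v in [set v : 'cV[R]_N.+1 | `|v| <= 1]].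
  have ge0 : 0 <= \sum_i \sum_j `|A i j|.
    by apply: sumr_ge0 => k _; apply: sumr_ge0 => l _.
  exists (\sum_i \sum_j `|A i j|) => _ [v /= v1 <-]; apply: mx_norm_le => // k l.
  rewrite mxE (le_trans (ler_norm_sum _ _ _)) //.
  apply: (@le_trans _ _ (\sum_j `|A k j|)).
    apply: ler_sum => j' _; rewrite normrM ler_piMr // (le_trans _ v1) //.
    exact: mx_norm_entry.
  rewrite [leRHS](bigD1 k) //= lerDl.
  by apply: sumr_ge0 => k' _; apply: sumr_ge0 => l' _.
apply: (ub_le_sup ub); exists (delta_mx j 0) => //=.
apply: mx_norm_le => // k l.
by rewrite mxE; case: (_ && _); rewrite ?normr1 ?normr0.
Qed.

Lemma bernstein_ge0 (R : realType) (a b : R) N i x : a < b -> x \in `[a, b] ->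
  0 <= bernstein a b N i x.
Proof.
rewrite in_itv /= => ab /andP[ax xb]; rewrite /bernstein !mulr_ge0 ?exprn_ge0 //.
  by rewrite mulr_ge0 ?invr_ge0 ?subr_ge0 ?(ltW ab).
by rewrite mulr_ge0 ?invr_ge0 ?subr_ge0 ?(ltW ab).
Qed.

Lemma bernstein_sum1 (R : realType) (a b : R) N x : a < b ->
  \sum_(i < N.+1) bernstein a b N i x = 1.
Proof.
move=> ab; transitivity (((b - x) / (b - a) + (x - a) / (b - a)) ^+ N).
  by rewrite exprDn; apply: eq_bigr => i _; rewrite /bernstein -mulrA mulr_natl.
have -> : (b - x) / (b - a) + (x - a) / (b - a) = 1; last by rewrite expr1n.
field.
by rewrite subr_eq0 gt_eqF.
Qed.

(** The Bernstein polynomials are nonnegative with sum 1 on [a, b], so a polynomial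
    is bounded by the largest of its Bernstein coefficients. *)
Lemma dual_basis_le (R : realType) (a b : R) M N (i : 'I_N.+1) x :
  a < b -> (N %| M)%N -> (N <= M)%N -> x \in `[a, b] ->
  `|(dual_basis a b M N i).[x]| <= mx_opnorm (invmx (elevation_sub R M N)).
Proof.
move=> ab NM leNM xab; have [[sD _] muD] := dual_basisP ab NM leNM.
rewrite (poly_lambda ab (sD i)) (le_trans (ler_norm_sum _ _ _)) //.
rewrite -[leRHS]mulr1 -(bernstein_sum1 N x ab) mulr_sumr; apply: ler_sum => k _.
rewrite normrM (ger0_norm (bernstein_ge0 _ _ ab xab)) ler_wpM2r ?bernstein_ge0 //.
rewrite (lambda_mu ab NM leNM) // (bigD1 i) //= muD eqxx mulr1 big1 ?addr0.
  exact: mx_opnorm_ge.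
by move=> j ji; rewrite muD (negbTE ji) mulr0.
Qed.

Lemma proj_le (R : realType) (a b : R) (C : nat -> R) M N f s x :
  a < b -> (N %| M)%N -> (N <= M)%N -> lambda_bound a b M (C M) ->
  {within `[a, b], continuous f} -> (forall x, x \in `[a, b] -> `|f x| <= s) ->
  x \in `[a, b] -> `|Defs.proj a b M N f x| <= proj_const C M N * s.
Proof.
move=> ab NM leNM CP cf fs xab; rewrite /Defs.proj (le_trans (ler_norm_sum _ _ _)) //.
apply: (@le_trans _ _ (\sum_(i < N.+1) (C M * s) * mx_opnorm (invmx (elevation_sub R M N)))).
  apply: ler_sum => i _; rewrite normrM ler_pM //; last exact: dual_basis_le.
  exact: lambda_le.
rewrite sumr_const card_ord -mulr_natl /proj_const.
by rewrite le_eqVlt; apply/orP; left; apply/eqP; ring.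
Qed.

(** * Derivatives relative to a closed interval *)

(** g is the derivative of f at every point of [a, b], with difference quotients
    taken inside [a, b]; the derivative is thus one-sided at a and b. *)
Definition within_deriv (R : realType) (a b : R) (f g : R -> R) : Prop :=
  forall x, x \in `[a, b] ->
    (f t - f x) / (t - x) @[t --> within `[a, b]%classic (dnbhs x)] --> g x.

Lemma near_within_dnbhs_neq (R : realType) (a b x : R) :
  \forall t \near within `[a, b]%classic (dnbhs x), t != x.
Proof. by apply: cvg_within; exact: withinT. Qed.

Lemma cvg_within_dnbhs_id (R : realType) (a b x : R) :
  t @[t --> within `[a, b]%classic (dnbhs x)] --> x.
Proof.
apply: cvg_trans (_ : (t @[t --> nbhs x]) --> x); last exact: cvg_id.
by apply: cvg_app; apply: cvg_trans (cvg_within _) (cvg_within _).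
Qed.

Lemma within_deriv_poly (R : realType) (a b : R) (p : {poly R}) :
  within_deriv a b (horner p) (horner p^`()).
Proof.
move=> x _; have /factor_theorem [r pE] : root (p - p.[x]%:P) x.
  by rewrite /root !hornerE subrr.
have dE : p^`().[x] = r.[x].
  have /(congr1 (fun q : {poly R} => q^`().[x])) := pE.
  rewrite derivB derivC subr0 => ->.
  by rewrite derivM derivXsubC !hornerE subrr mulr0 add0r.
have qE t : p.[t] - p.[x] = r.[t] * (t - x).
  have /(congr1 (fun q : {poly R} => q.[t])) := pE.
  by rewrite !hornerE.
rewrite dE; apply: cvg_trans (_ : r.[t] @[t --> within `[a, b]%classic (dnbhs x)] --> r.[x]).
  apply: near_eq_cvg; near=> t; rewrite qE mulfK // subr_eq0.
  by near: t; exact: near_within_dnbhs_neq.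
apply: (@cvg_comp _ _ _ _ _ _ (nbhs x)); first exact: cvg_within_dnbhs_id.
exact: continuous_horner.
Unshelve. all: by end_near. Qed.

Lemma within_derivB (R : realType) (a b : R) (f f' g g' : R -> R) :
  within_deriv a b f f' -> within_deriv a b g g' ->
  within_deriv a b (fun x => f x - g x) (fun x => f' x - g' x).
Proof.
move=> df dg x xab; 
have -> : (fun t => (f t - g t - (f x - g x)) / (t - x))
    = (fun t => (f t - f x) / (t - x) - (g t - g x) / (t - x)).
  by apply/funext => t; rewrite -mulrBl; congr (_ * _); ring.
by apply: cvgB; [exact: df|exact: dg].
Qed.

Lemma cvg_sum_ord (R : realType) (T : Type) (F : set_system T) q
    (f : 'I_q -> T -> R) (l : 'I_q -> R) : Filter F ->
  (forall s, f s t @[t --> F] --> l s) ->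
  (\sum_s f s t) @[t --> F] --> \sum_s l s.
Proof.
move=> FF; elim: q f l => [|q IH] f l fl.
  rewrite big_ord0; under eq_fun do rewrite big_ord0; exact: cvg_cst.
rewrite big_ord_recr; under eq_fun do rewrite big_ord_recr.
by apply: cvgD; [apply: IH => s|]; exact: fl.
Qed.

Lemma within_deriv_sum (R : realType) (a b : R) q (f f' : 'I_q -> R -> R)
    (c : 'I_q -> R) :
  (forall s, within_deriv a b (f s) (f' s)) ->
  within_deriv a b (fun x => \sum_s f s x * c s) (fun x => \sum_s f' s x * c s).
Proof.
move=> df x xab.
have -> : (fun t => (\sum_s f s t * c s - \sum_s f s x * c s) / (t - x))
    = fun t => \sum_s (f s t - f s x) / (t - x) * c s.
  apply/funext => t; rewrite -sumrB mulr_suml; apply: eq_bigr => s _; ring.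
apply: cvg_sum_ord => s; apply: cvgM; [exact: df|exact: cvg_cst].
Qed.

Lemma within_deriv_cont (R : realType) (a b : R) (f f' : R -> R) :
  within_deriv a b f f' -> {within `[a, b], continuous f}.
Proof.
move=> df; apply/subspace_continuousP => x xab.
have H : f t @[t --> within `[a, b]%classic (dnbhs x)] --> f x.
  have -> : f x = f' x * (x - x) + f x by rewrite subrr mulr0 add0r.
  apply: cvg_trans (_ : ((f t - f x) / (t - x) * (t - x) + f x)
     @[t --> within `[a, b]%classic (dnbhs x)] --> _).
    apply: near_eq_cvg; near=> t; rewrite mulfVK ?subrK // subr_eq0.
    by near: t; exact: near_within_dnbhs_neq.
  apply: cvgD; last exact: cvg_cst.
  apply: cvgM; first exact: df.
  by apply: cvgB; [exact: cvg_within_dnbhs_id|exact: cvg_cst].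
apply/cvgrPdist_lt => e e0; move/cvgrPdist_lt: H => /(_ e e0).
move=> H'.
have {}H' : \forall t \near nbhs x, t != x -> `[a, b]%classic t -> `|f x - f t| < e by [].
suff : \forall t \near nbhs x, `[a, b]%classic t -> `|f x - f t| < e by [].
apply: filterS H' => t Ht tab.
have [->|tx] := eqVneq t x; first by rewrite subrr normr0.
exact: Ht.
Unshelve. all: by end_near. Qed.

(** In the interior, the relative derivative is the ordinary one. *)
Lemma within_deriv_interior (R : realType) (a b : R) (f f' : R -> R) x :
  within_deriv a b f f' -> x \in `]a, b[ -> is_derive x 1 f (f' x).
Proof.
move=> df xab; have := df x (subset_itv_oo_cc xab) => H.
have D : (fun h => h^-1 *: (f (h *: 1 + x) - f x)) @ 0^' --> f' x.
  apply/cvgrPdist_lt => e e0; move/cvgrPdist_lt: H => /(_ e e0).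
  rewrite /within /= /dnbhs /within /=.
  case/nbhs_ballP => d /= d0 Hd.
  move: xab; rewrite in_itv /= => /andP[ax xb].
  (* a' is small enough for x + h to stay in [a, b]. *)
  have [a' a'0] : {a' | 0 < a' & a' <= d /\ x - a' >= a /\ x + a' <= b}.
    exists (Num.min d (Num.min (x - a) (b - x))).
      by rewrite !lt_min d0 !subr_gt0 ax xb.
    split; first by rewrite ge_min lexx.
    split.
      by rewrite lerBrDr addrC -lerBrDr !ge_min lexx orbT /= ?orbT.
    by rewrite addrC -lerBrDr !ge_min lexx !orbT.
  case=> a'd [xa' xb'].
  apply/nbhs_ballP; exists a' => //= h; rewrite /ball /= sub0r normrN => ha h0.
  have hE : h *: (1 : R) = h by rewrite /GRing.scale /= mulr1.
  rewrite hE; have := Hd (h + x); rewrite /ball /=.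
  rewrite opprD addrCA subrr addr0 normrN (lt_le_trans ha a'd) => /(_ isT).
  rewrite -subr_eq0 addrK => /(_ h0).
  rewrite in_itv /=.
  move: ha; rewrite ltr_norml => /andP[h1 h2].
  have -> : (a <= h + x <= b)%R by apply/andP; split; lra.
  by move=> /(_ isT); rewrite mulrC.
split; first by apply/cvg_ex; exists (f' x).
exact: cvg_lim D.
Qed.

(** * The error of polynomial interpolation *)

(** Rolle's theorem between consecutive zeros: from n + 1 zeros of f in increasing
    order to n zeros of its derivative.  The first zero x is kept apart from the
    list s of the others, and all the new zeros are beyond x. *)
Lemma rolle_path (R : realType) (a b : R) (f f' : R -> R) (s : seq R) (x : R) :
  within_deriv a b f f' -> path <%R x s ->
  (forall y, y \in x :: s -> y \in `[a, b] /\ f y = 0) ->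
  exists s', [/\ size s' = size s, path <%R x s' &
    forall y, y \in s' -> y \in `[a, b] /\ f' y = 0].
Proof.
move=> df; elim: s x => [|y s IH] x; first by move=> _ _; exists [::].
move=> /= /andP[xy ps] zs.
have [|s' [ss' ps' zs']] := IH y ps.
  by move=> z zys; apply: zs; rewrite inE zys orbT.
have [xab fx0] := zs x (mem_head _ _).
have [yab fy0] : y \in `[a, b] /\ f y = 0 by apply: zs; rewrite !inE eqxx orbT.
have sub : forall z, z \in `[x, y] -> z \in `[a, b].
  move: xab yab; rewrite !in_itv /= => /andP[ax _] /andP[_ yb] z.
  rewrite !in_itv /= => /andP[xz zy].
  by rewrite (le_trans ax xz) (le_trans zy yb).
have sub' : forall z, z \in `]x, y[ -> z \in `]a, b[.
  move: xab yab; rewrite !in_itv /= => /andP[ax _] /andP[_ yb] z.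
  by rewrite !in_itv /= => /andP[xz zy]; rewrite (le_lt_trans ax xz) (lt_le_trans zy yb).
have [|||z zxy dz] := @Rolle R f x y xy.
- by move=> z /sub' /(within_deriv_interior df) [].
- apply: continuous_subspaceW (within_deriv_cont df); move=> z /=; exact: sub.
- by rewrite fx0 fy0.
exists (z :: s'); split; first by rewrite /= ss'.
  move: zxy; rewrite in_itv /= => /andP[xz zy]; rewrite xz /=.
  by apply: path_le ps'; [exact: lt_trans|].
move=> w; rewrite inE => /orP[/eqP ->|]; last exact: zs'.
split; first exact/sub/subset_itv_oo_cc.
have d1 := within_deriv_interior df (sub' _ zxy).
by rewrite -(@derive_val _ _ _ _ _ _ _ d1) (@derive_val _ _ _ _ _ _ _ dz).
Qed.

(** Iterated Rolle: a function with N + 1 zeros has an N-th derivative with a zero.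
    [g i] is the derivative of order i. *)
Lemma rolle_chain (R : realType) (a b : R) N (g : nat -> R -> R) (s : seq R) :
  (forall i, (i < N)%N -> within_deriv a b (g i) (g i.+1)) ->
  sorted <%R s -> size s = N.+1 ->
  (forall y, y \in s -> y \in `[a, b] /\ g 0%N y = 0) ->
  exists2 y, y \in `[a, b] & g N y = 0.
Proof.
elim: N g s => [|N IH] g [//|x s] dg /= ss sz zs.
  by have [] := zs x (mem_head _ _); exists x.
have [s' [sz' ps' zs']] := rolle_path (dg 0%N isT) ss zs.
apply: (IH (fun i => g i.+1) s') => //.
- by move=> i iN; apply: dg.
- exact: path_sorted ps'.
- by rewrite sz'; case: sz.
Qed.

Lemma derivn_top (R : realType) N (p : {poly R}) :
  (size p <= N.+1)%N -> p^`(N) = (p`_N *+ N`!)%:P.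
Proof.
move=> sp; apply/polyP => i; rewrite coef_derivn coefC; case: i => [|i] /=.
  by rewrite addn0 ffactnn.
by rewrite nth_default ?mul0rn // (leq_trans sp) // addnS ltnS leq_addr.
Qed.

(** The classical error bound for the interpolation of [g 0] by a polynomial p with
    N nodes t, where [g i] is the derivative of order i and K bounds [g N]. *)
Lemma interp_error (R : realType) (a b K : R) N (g : nat -> R -> R)
    (t : 'I_N -> R) (p : {poly R}) x :
  (forall i, (i < N)%N -> within_deriv a b (g i) (g i.+1)) ->
  injective t -> (forall i, t i \in `[a, b]) ->
  (size p <= N)%N -> (forall i, p.[t i] = g 0%N (t i)) ->
  (forall y, y \in `[a, b] -> `|g N y| <= K) -> x \in `[a, b] ->
  `|g 0%N x - p.[x]| <= K / N`!%:R * `|\prod_i (x - t i)|.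
Proof.
move=> dg tI tab sp pt gK xab.
have [/codomP [i ->]|xt] := boolP (x \in codom t).
  rewrite pt subrr normr0 mulr_ge0 // divr_ge0 //.
  exact: le_trans (gK x xab).
pose w : {poly R} := \prod_i ('X - (t i)%:P).
have wE y : w.[y] = \prod_i (y - t i).
  by rewrite horner_prod; apply: eq_bigr => i _; rewrite hornerXsubC.
have wx : w.[x] != 0.
  rewrite wE; apply/prodf_neq0 => i _; rewrite subr_eq0.
  by apply/eqP => xE; move: xt; rewrite xE codom_f.
have sw : size w = N.+1.
  rewrite size_prod => [|i _]; last by rewrite polyXsubC_eq0.
  by under eq_bigr do rewrite size_XsubC; rewrite sum_nat_const card_ord; lia.
have wt i : w.[t i] = 0 by rewrite wE (bigD1 i) //= subrr mul0r.
pose k := (g 0%N x - p.[x]) / w.[x].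
(* k is chosen so that g 0 - q also vanishes at x, which gives N + 1 zeros. *)
pose q := p + k *: w.
have sq : (size q <= N.+1)%N.
  rewrite (leq_trans (size_polyD _ _)) // geq_max (leq_trans sp) //=.
  by rewrite (leq_trans (size_scale_leq _ _)) // sw.
have qN : q`_N = k.
  rewrite coefD coefZ nth_default // add0r.
  have /monicP : w \is monic by apply: rpred_prod => i _; exact: monicXsubC.
  by rewrite /lead_coef sw /= => ->; rewrite mulr1.
have [||||y yab] := @rolle_chain R a b N (fun i y => g i y - q^`(i).[y])
    (sort <=%R (x :: codom t)).
- move=> i iN; apply: within_derivB; first exact: dg.
  by rewrite derivnS; apply: within_deriv_poly.
- rewrite lt_sorted_uniq_le sort_uniq sort_sorted ?andbT; last exact: le_total.
  by rewrite /= xt map_inj_uniq ?enum_uniq.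
- by rewrite size_sort /= size_codom card_ord.
- move=> y; rewrite mem_sort inE => /orP[/eqP ->|/codomP [i ->]].
    by split=> //; rewrite derivn0 hornerD hornerZ divfK //; ring.
  by split=> //; rewrite derivn0 hornerD hornerZ pt wt mulr0 addr0 subrr.
rewrite (derivn_top sq) hornerC qN => /eqP; rewrite subr_eq0 => /eqP gy.
have N0 : N`!%:R != 0 :> R by rewrite pnatr_eq0 -lt0n fact_gt0.
have -> : g 0%N x - p.[x] = g N y / N`!%:R * \prod_i (x - t i).
  by rewrite gy -wE -(mulr_natr k) mulfK // divfK.
rewrite normrM ler_wpM2r // normrM normfV normr_nat ler_wpM2r ?invr_ge0 //.
exact: gK.
Qed.

(** * Interpolation at symmetric nodes *)

(** The Lagrange basis polynomials for the nodes t. *)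
Definition lagrange_poly (R : realType) N (t : 'I_N -> R) (i : 'I_N) : {poly R} :=
  \prod_(j | j != i) ((t i - t j)^-1 *: ('X - (t j)%:P)).

Lemma size_lagrange_poly (R : realType) N (t : 'I_N -> R) i :
  (size (lagrange_poly t i) <= N)%N.
Proof.
apply: leq_trans (size_poly_prod_leq _ _) _.
have cN : #|[pred j : 'I_N | j != i]| = N.-1 by rewrite -[N in RHS]card_ord (cardC1 i).
have : (\sum_(j | j != i) size ((t i - t j)^-1 *: ('X - (t j)%:P))%R <= \sum_(j | j != i) 2)%N.
  apply: leq_sum => j _.
  by rewrite (leq_trans (size_scale_leq _ _)) // size_XsubC.
rewrite sum_nat_const cN; move: (\sum_(j | _) _)%N => u.
by have := ltn_ord i; lia.
Qed.

Lemma lagrange_polyE (R : realType) N (t : 'I_N -> R) i j : injective t ->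
  (lagrange_poly t i).[t j] = (i == j)%:R.
Proof.
move=> tI; rewrite horner_prod; have [->|ij] := eqVneq i j.
  apply: big1 => k kj; rewrite hornerZ hornerXsubC mulVf // subr_eq0.
  by apply: contraNneq kj => /tI ->.
by rewrite (bigD1 j) 1?eq_sym //= hornerZ hornerXsubC subrr mulr0 mul0r.
Qed.

(** The operator sum_s f(t_s) u_s with polynomials u_s.  All the univariate operators
    of the proof have this form, which makes linearity, preservation of continuity
    and commutation in different variables immediate. *)
Definition nodal (R : realType) q (t : 'I_q -> R) (u : 'I_q -> {poly R})
    (f : R -> R) : R -> R :=
  fun x => \sum_s f (t s) * (u s).[x].

(** N equidistant nodes in the interior of [a, b], symmetric about its midpoint. *)
Definition sym_node (R : realType) (a b : R) N (i : 'I_N) : R :=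
  a + (b - a) * (i.+1%:R / N.+1%:R).

Lemma sym_node_inj (R : realType) (a b : R) N : a < b -> injective (@sym_node R a b N).
Proof.
move=> ab i j /addrI /(mulfI _); rewrite subr_eq0 gt_eqF // => /(_ isT).
move=> /(mulIf _); rewrite invr_eq0 pnatr_eq0 => /(_ isT) /eqP.
by rewrite eqr_nat eqSS => /eqP/val_inj.
Qed.

Lemma sym_node_itv (R : realType) (a b : R) N (i : 'I_N) : a < b ->
  sym_node a b i \in `[a, b].
Proof.
move=> ab; have ba : 0 < b - a by rewrite subr_gt0.
have le1 : (i.+1%:R / N.+1%:R : R) <= 1.
  by rewrite ler_pdivrMr ?ltr0n // mul1r ler_nat ltnW // ltnS.
have ge0 : 0 <= (i.+1%:R / N.+1%:R : R) by rewrite divr_ge0.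
rewrite in_itv /= /sym_node; apply/andP; split; first by rewrite lerDl mulr_ge0 // ltW.
by rewrite -lerBrDl ler_piMr // ltW.
Qed.

Lemma sym_node_rev (R : realType) (a b : R) N (i : 'I_N) :
  sym_node a b (rev_ord i) = a + b - sym_node a b i.
Proof.
rewrite /sym_node /=.
have -> : (N - i.+1).+1%:R = N.+1%:R - i.+1%:R :> R.
  by rewrite -subSn // natrB // ltnW // ltnS.
have N0 : N.+1%:R != 0 :> R by rewrite pnatr_eq0.
by field.
Qed.

(** Pairing a node u with its mirror image: |(x - u) (x - (a + b - u))| is at most
    ((b - a)/2)^2 for x and u in [a, b].  The product of these factors over all nodes
    is the square of the node polynomial. *)
Lemma prod_sym_node (R : realType) (a b : R) N x : a < b -> x \in `[a, b] ->
  `|\prod_(i < N) (x - sym_node a b i)| <= ((b - a) / 2) ^+ N.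
Proof.
move=> ab xab; have h0 : 0 <= (b - a) / 2 by rewrite divr_ge0 // subr_ge0 ltW.
(* Compare squares, and reindex one of the two factors by the mirror image. *)
rewrite -(@ler_pXn2r _ 2) ?nnegrE ?exprn_ge0 // -exprM mulnC exprM.
rewrite expr2 -normrM [X in `|_ * X|](reindex_inj rev_ord_inj) /= -big_split /=.
rewrite normr_prod -[leRHS](_ : \prod_(i < N) ((b - a) / 2) ^+ 2 = _); last first.
  by rewrite prodr_const card_ord.
apply: ler_prod => i _; rewrite normr_ge0 /= sym_node_rev.
move: (sym_node_itv i ab) xab; rewrite !in_itv /=; move: (sym_node _ _ _) => u.
move=> /andP[au ub] /andP[ax xb].
have pu : 0 <= (u - a) * (b - u) by rewrite mulr_ge0 // subr_ge0.
have px : 0 <= (x - a) * (b - x) by rewrite mulr_ge0 // subr_ge0.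
have su : 0 <= (u - (a + b) / 2) ^+ 2 by exact: sqr_ge0.
have sx : 0 <= (x - (a + b) / 2) ^+ 2 by exact: sqr_ge0.
by rewrite ler_norml; apply/andP; split; nra.
Qed.

(** Lagrange interpolation with N symmetric nodes; it is 0 for N = 0. *)
Definition interp (R : realType) (a b : R) N : (R -> R) -> R -> R :=
  nodal (@sym_node R a b N) (lagrange_poly (@sym_node R a b N)).

Lemma nodalE (R : realType) q (t : 'I_q -> R) u f :
  nodal t u f = horner (\sum_s f (t s) *: u s).
Proof.
by apply/funext => x; rewrite horner_sum; apply: eq_bigr => s _; rewrite hornerZ.
Qed.

Lemma size_interp (R : realType) (a b : R) N (f : R -> R) :
  (size (\sum_s f (sym_node a b s) *: lagrange_poly (@sym_node R a b N) s)%R <= N)%N.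
Proof. by apply: size_sum_scale_le => s; exact: size_lagrange_poly. Qed.

Lemma interp_sym_error (R : realType) (a b K : R) N (g : nat -> R -> R) x :
  a < b -> (forall i, (i < N)%N -> within_deriv a b (g i) (g i.+1)) ->
  (forall y, y \in `[a, b] -> `|g N y| <= K) -> x \in `[a, b] ->
  `|g 0%N x - interp a b N (g 0%N) x| <= K / N`!%:R * ((b - a) / 2) ^+ N.
Proof.
move=> ab dg gK xab; rewrite /interp nodalE.
set p := \sum_s _.
have sp : (size p <= N)%N by exact: size_interp.
have K0 : 0 <= K by exact: le_trans (gK x xab).
apply: le_trans (interp_error dg (@sym_node_inj R a b N ab) _ sp _ gK xab) _.
- by move=> i; apply: sym_node_itv.
- move=> i; rewrite horner_sum (bigD1 i) //= hornerZ lagrange_polyE; last exact: sym_node_inj.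
  rewrite eqxx mulr1 big1 ?addr0 // => j ji.
  by rewrite hornerZ lagrange_polyE ?(negbTE ji) ?mulr0 //; exact: sym_node_inj.
- by rewrite ler_wpM2l ?divr_ge0 // prod_sym_node.
Qed.

(** * The algebra of blended Boolean sums *)

(** The Boolean sum of the operators X_(k+1, r-k+1), for a family X of additive
    operators which multiply as X_(k,l) X_(k',l') = X_(min k k', min l l') and vanish
    for l = 0.  Indices are shifted by one, so that 0 stands for the index -1. *)
Lemma bool_sum_chain (R : realType) (r : nat)
    (X : nat -> nat -> (R * R -> R) -> R * R -> R) (F : R * R -> R) :
  (forall k l f g, X k l (f \- g) = X k l f \- X k l g) ->
  (forall k l f g, X k l (f \+ g) = X k l f \+ X k l g) ->
  (forall k, X k 0%N F = fun=> 0) ->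
  (forall k l k' l' f, (k <= r.+1)%N -> (l <= r.+1)%N -> (k' <= r.+1)%N -> (l' <= r.+1)%N ->
     X k l (X k' l' f) = X (minn k k') (minn l l') f) ->
  (\big[@bool_sum R/@op0 R]_(k < r.+1) X k.+1 (r - k).+1) F
  = fun z => \sum_(k < r.+1) (X k.+1 (r - k).+1 F z - X k.+1 (r - k)%N F z).
Proof.
move=> XB XD X0 XX.
have Xc0 k l : X k l (fun=> 0) = fun=> 0.
  have := XB k l F F; rewrite (_ : F \- F = fun=> 0); last first.
    by apply/funext => z; rewrite /= subrr.
  by move=> ->; apply/funext => z; rewrite /= subrr.
pose D s := (\big[@bool_sum R/@op0 R]_(s <= k < r.+1) X k.+1 (r - k).+1) F.
have DS s : (s <= r)%N -> D s = (X s.+1 (r - s).+1 F \+ D s.+1)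
                              \- X s.+1 (r - s).+1 (D s.+1).
  by move=> sr; rewrite /D big_ltn.
(* To an operator of low first and high second index, the partial Boolean sum D s
   looks like the projector of second index r + 1 - s; the induction on i descends
   in s. *)
have XDs i s k l : (s + i)%N = r.+1 -> (k <= s.+1)%N -> (k <= r.+1)%N -> (r.+1 - s <= l)%N ->
    (l <= r.+1)%N -> X k l (D s) = X k (r.+1 - s)%N F.
  elim: i s k l => [|i IH] s k l si ks kr sl lr.
    have -> : s = r.+1 by lia.
    by rewrite /D big_geq // /op0 Xc0 subnn X0.
  have sr : (s <= r)%N by lia.
  have E1 : (r.+1 - s = (r - s).+1)%N by lia.
  have E2 : (r.+1 - s.+1 = r - s)%N by lia.
  rewrite DS // XB XD !XX // ?ltnS ?leq_subr //.
  rewrite (minn_idPl ks) (minn_idPr _); last by rewrite -E1.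
  rewrite (IH s.+1 k l) ?(IH s.+1 k (r - s).+1) //; try lia.
  by rewrite E1; apply/funext => z /=; rewrite addrK.
have DE i s : (s + i)%N = r.+1 -> D s = fun z =>
    \sum_(s <= k < r.+1) (X k.+1 (r - k).+1 F z - X k.+1 (r - k)%N F z).
  elim: i s => [|i IH] s si.
    have -> : s = r.+1 by lia.
    by rewrite /D big_geq //; apply/funext => z; rewrite big_geq.
  have sr : (s <= r)%N by lia.
  rewrite DS // (XDs i) //; try lia.
  rewrite (IH s.+1) ?addSnnS // subSS; apply/funext => z /=.
  by rewrite [RHS]big_ltn //; ring.
rewrite -(big_mkord xpredT (fun k => X k.+1 (r - k).+1)) -/(D 0%N) (DE r.+1) //.
by apply/funext => z; rewrite big_mkord.
Qed.

(** The value v of F at a point minus that of the blended Boolean sum, as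
    a difference of sums of complements; p, q and x are the values of P_k F, Q_l F and
    P_k Q_l F, with indices shifted by one. *)
Lemma bool_sum_residual (R : realType) (r : nat) (v : R) (p q : nat -> R)
    (x : nat -> nat -> R) :
  p 0%N = 0 -> q 0%N = 0 -> (forall l, x 0%N l = 0) ->
  v - \sum_(k < r.+1) (x k.+1 (r - k).+1 - x k.+1 (r - k)%N)
  = \sum_(k < r.+2) (v - (p k + q (r.+1 - k)%N - x k (r.+1 - k)%N))
    - \sum_(k < r.+1) (v - (p k.+1 + q (r - k).+1 - x k.+1 (r - k).+1)).
Proof.
move=> p0 q0 x0; rewrite [in RHS]big_ord_recl /= p0 x0 subn0 -addrA -sumrB.
have qT : \sum_(k < r.+1) (q (r - k).+1 - q (r - k)%N) = q r.+1.
  rewrite (reindex_inj rev_ord_inj) /=.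
  transitivity (\sum_(0 <= k < r.+1) (q k.+1 - q k)).
    by rewrite big_mkord; apply: eq_bigr => k _; rewrite subSS subKn // -ltnS.
  by rewrite telescope_sumr // q0 subr0.
set S := \sum_(i < r.+1) (v - _ - _).
have -> : S = q r.+1 - \sum_(k < r.+1) (x k.+1 (r - k).+1 - x k.+1 (r - k)%N).
  rewrite -qT -sumrB; apply: eq_bigr => k _.
  by rewrite /bump /= add1n subSS; ring.
by ring.
Qed.

(** * Univariate operators acting in one of two variables *)

(** The action of a univariate operator in the first variable. *)
Definition liftx (R : realType) (A : (R -> R) -> R -> R) (F : R * R -> R) : R * R -> R :=
  fun z => A (fun x => F (x, z.2)) z.1.

(** The action of a univariate operator in the second variable. *)
Definition lifty (R : realType) (A : (R -> R) -> R -> R) (F : R * R -> R) : R * R -> R :=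
  fun z => A (fun y => F (z.1, y)) z.2.

(** A is a nodal operator with nodes in [a, b]. *)
Definition is_nodal (R : realType) (a b : R) (A : (R -> R) -> R -> R) : Prop :=
  exists q (t : 'I_q -> R) (u : 'I_q -> {poly R}),
    (forall s, t s \in `[a, b]) /\ A = nodal t u.

Lemma is_nodal_interp (R : realType) (a b : R) N : a < b ->
  is_nodal a b (interp a b N).
Proof.
move=> ab; exists N, (@sym_node R a b N), (lagrange_poly (@sym_node R a b N)).
by split=> // s; apply: sym_node_itv.
Qed.

Lemma is_nodal0 (R : realType) (a b : R) : is_nodal a b (fun _ _ => 0).
Proof.
exists 0%N, (fun=> a), (fun=> 0); split; first by case.
by apply/funext => f; apply/funext => x; rewrite /nodal big_ord0.
Qed.

Lemma is_nodal_proj (R : realType) (a b : R) M N : a < b ->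
  is_nodal a b (Defs.proj a b M N).
Proof.
move=> ab; exists M.+1, (fun s => node a b M s), (fun s =>
  \sum_(i < N.+1) invmx (collocation a b M) (alpha M i) s *: dual_basis a b M N i).
split; first by move=> s; apply: node_itv.
apply/funext => f; apply/funext => x; rewrite /nodal /Defs.proj /mu /lambda.
under eq_bigr do rewrite mulr_suml.
rewrite exchange_big; apply: eq_bigr => s _; rewrite horner_sum mulr_sumr.
by apply: eq_bigr => i _; rewrite hornerZ mulrCA mulrA.
Qed.

Lemma liftxB (R : realType) (a b : R) A (F G : R * R -> R) : is_nodal a b A ->
  liftx A (F \- G) = liftx A F \- liftx A G.
Proof.
move=> [q [t [u [_ ->]]]]; apply/funext => z; rewrite /liftx /nodal /= -sumrB.
by apply: eq_bigr => s _; rewrite mulrBl.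
Qed.

Lemma liftyB (R : realType) (a b : R) A (F G : R * R -> R) : is_nodal a b A ->
  lifty A (F \- G) = lifty A F \- lifty A G.
Proof.
move=> [q [t [u [_ ->]]]]; apply/funext => z; rewrite /lifty /nodal /= -sumrB.
by apply: eq_bigr => s _; rewrite mulrBl.
Qed.

Lemma liftxD (R : realType) (a b : R) A (F G : R * R -> R) : is_nodal a b A ->
  liftx A (F \+ G) = liftx A F \+ liftx A G.
Proof.
move=> [q [t [u [_ ->]]]]; apply/funext => z; rewrite /liftx /nodal /= -big_split.
by apply: eq_bigr => s _; rewrite mulrDl.
Qed.

Lemma liftyD (R : realType) (a b : R) A (F G : R * R -> R) : is_nodal a b A ->
  lifty A (F \+ G) = lifty A F \+ lifty A G.
Proof.
move=> [q [t [u [_ ->]]]]; apply/funext => z; rewrite /lifty /nodal /= -big_split.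
by apply: eq_bigr => s _; rewrite mulrDl.
Qed.

Lemma liftxZ (R : realType) (a b : R) A (k : R) (F : R * R -> R) : is_nodal a b A ->
  liftx A (fun z => k * F z) = fun z => k * liftx A F z.
Proof.
move=> [q [t [u [_ ->]]]]; apply/funext => z; rewrite /liftx /nodal /= mulr_sumr.
by apply: eq_bigr => s _; rewrite mulrA.
Qed.

Lemma liftyZ (R : realType) (a b : R) A (k : R) (F : R * R -> R) : is_nodal a b A ->
  lifty A (fun z => k * F z) = fun z => k * lifty A F z.
Proof.
move=> [q [t [u [_ ->]]]]; apply/funext => z; rewrite /lifty /nodal /= mulr_sumr.
by apply: eq_bigr => s _; rewrite mulrA.
Qed.

Lemma lift_comm (R : realType) (a b c d : R) A B (F : R * R -> R) :
  is_nodal a b A -> is_nodal c d B ->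
  liftx A (lifty B F) = lifty B (liftx A F).
Proof.
move=> [q [t [u [_ ->]]]] [q' [t' [u' [_ ->]]]]; apply/funext => z.
rewrite /liftx /lifty /nodal /=; under eq_bigr do rewrite mulr_suml.
rewrite exchange_big; apply: eq_bigr => s _; rewrite mulr_suml.
by apply: eq_bigr => i _; rewrite mulrAC.
Qed.

Lemma within_continuous_comp (R : realType) (S T : topologicalType) (A : set S) (B : set T)
    (phi : S -> T) (G : T -> R) :
  (forall x, A x -> B (phi x)) -> continuous phi -> {within B, continuous G} ->
  {within A, continuous (G \o phi)}.
Proof.
move=> AB cphi /subspace_continuousP cG; apply/subspace_continuousP => x Ax.
apply: (@cvg_comp _ _ _ phi G _ (within B (nbhs (phi x)))); last exact/cG/AB.
move=> P; rewrite /within /= => BP.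
have := cphi x _ BP; rewrite /nbhs /=; apply: filterS => y yP Ay.
exact/yP/AB.
Qed.

Lemma continuous_pair (S T U : topologicalType) (f : S -> T) (g : S -> U) :
  continuous f -> continuous g -> continuous (fun x => (f x, g x)).
Proof.
move=> cf cg x; apply: (@cvg_pair _ _ _ (nbhs x) (nbhs (f x)) (nbhs (g x))).
  exact: cf.
exact: cg.
Qed.

Lemma continuous_fst (S T : topologicalType) : continuous (@fst S T).
Proof. move=> [x y]; exact: (@cvg_fst _ _ (nbhs x) (nbhs y)). Qed.

Lemma continuous_snd (S T : topologicalType) : continuous (@snd S T).
Proof. move=> [x y]; exact: (@cvg_snd _ _ (nbhs x) (nbhs y)). Qed.

Lemma rect_slicex (R : realType) (a b c d y : R) (G : R * R -> R) :
  y \in `[c, d] -> {within rect a b c d, continuous G} ->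
  {within `[a, b], continuous (fun x => G (x, y))}.
Proof.
move=> yI; apply: (@within_continuous_comp _ _ _ _ _ (fun x => (x, y))) => //.
by apply: continuous_pair => x; [exact: cvg_id|exact: cvg_cst].
Qed.

Lemma rect_slicey (R : realType) (a b c d x : R) (G : R * R -> R) :
  x \in `[a, b] -> {within rect a b c d, continuous G} ->
  {within `[c, d], continuous (fun y => G (x, y))}.
Proof.
move=> xI; apply: (@within_continuous_comp _ _ _ _ _ (fun y => (x, y))) => //.
by apply: continuous_pair => y; [exact: cvg_cst|exact: cvg_id].
Qed.

Lemma within_continuous_sum (R : realType) (T : topologicalType) (D : set T) q
    (f g : 'I_q -> T -> R) :
  (forall s, {within D, continuous (f s)}) -> (forall s, continuous (g s)) ->
  {within D, continuous (fun z => \sum_s f s z * g s z)}.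
Proof.
move=> cf cg; apply/subspace_continuousP => x Dx; apply: cvg_sum_ord => s.
apply: cvgM; first by move/subspace_continuousP: (cf s); exact.
exact: cvg_trans (cvg_app _ (cvg_within _)) (cg s x).
Qed.

Lemma liftx_continuous (R : realType) (a b c d : R) A (F : R * R -> R) :
  is_nodal a b A -> {within rect a b c d, continuous F} ->
  {within rect a b c d, continuous (liftx A F)}.
Proof.
move=> [q [t [u [tab ->]]]] cF.
apply: (@within_continuous_sum _ _ _ _ (fun s z => F (t s, z.2)) (fun s z => (u s).[z.1])) => s.
  apply: (@within_continuous_comp _ _ _ _ _ (fun z => (t s, z.2))) cF.
    by move=> z [_ z2]; split=> //; exact: tab.
  by apply: continuous_pair; [move=> z; exact: cvg_cst|exact: continuous_snd].
move=> z; apply: (@continuous_comp _ _ _ fst (horner (u s))).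
  exact: continuous_fst.
exact: continuous_horner.
Qed.

Lemma lifty_continuous (R : realType) (a b c d : R) A (F : R * R -> R) :
  is_nodal c d A -> {within rect a b c d, continuous F} ->
  {within rect a b c d, continuous (lifty A F)}.
Proof.
move=> [q [t [u [tab ->]]]] cF.
apply: (@within_continuous_sum _ _ _ _ (fun s z => F (z.1, t s)) (fun s z => (u s).[z.2])) => s.
  apply: (@within_continuous_comp _ _ _ _ _ (fun z => (z.1, t s))) cF.
    by move=> z [z1 _]; split=> //; exact: tab.
  by apply: continuous_pair; [exact: continuous_fst|move=> z; exact: cvg_cst].
move=> z; apply: (@continuous_comp _ _ _ snd (horner (u s))).
  exact: continuous_snd.
exact: continuous_horner.
Qed.

Lemma within_continuousB (R : realType) (T : topologicalType) (D : set T) (f g : T -> R) :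
  {within D, continuous f} -> {within D, continuous g} ->
  {within D, continuous (f \- g)}.
Proof.
move=> /subspace_continuousP cf /subspace_continuousP cg.
by apply/subspace_continuousP => x Dx; apply: cvgB; [exact: cf|exact: cg].
Qed.

(** K bounds the norm of A on the continuous functions on [a, b], both norms being
    supremum norms over [a, b]. *)
Definition bounded_by (R : realType) (a b : R) (A : (R -> R) -> R -> R) (K : R) : Prop :=
  forall f s, {within `[a, b], continuous f} ->
    (forall x, x \in `[a, b] -> `|f x| <= s) ->
    forall x, x \in `[a, b] -> `|A f x| <= K * s.

Lemma bool_sum_le (R : realType) (a b c d : R) A B K L (G : R * R -> R) s :
  is_nodal a b A -> is_nodal c d B -> bounded_by a b A K -> bounded_by c d B L ->
  {within rect a b c d, continuous G} ->
  (forall z, rect a b c d z -> `|G z| <= s) ->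
  forall z, rect a b c d z ->
  `|bool_sum (liftx A) (lifty B) G z| <= (K + L + K * L) * s.
Proof.
move=> nA nB bA bB cG Gs [x y] [/= xab ycd].
have B1 x' : x' \in `[a, b] -> `|lifty B G (x', y)| <= L * s.
  move=> x'ab; apply: (bB (fun y => G (x', y))) => //; first exact: rect_slicey cG.
  by move=> y' y'cd; apply: Gs.
have A1 : `|liftx A G (x, y)| <= K * s.
  apply: (bA (fun x => G (x, y))) => //; first exact: rect_slicex cG.
  by move=> x' x'ab; apply: Gs.
have AB1 : `|liftx A (lifty B G) (x, y)| <= K * (L * s).
  apply: (bA (fun x => lifty B G (x, y))) => //.
  by apply: rect_slicex (lifty_continuous nB cG).
rewrite /bool_sum (le_trans (ler_normB _ _)) //.
rewrite mulrDl -mulrA lerD // mulrDl (le_trans (ler_normD _ _)) // lerD //.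
exact: B1.
Qed.

(** * The error of one Boolean sum *)

(** If A and B reproduce the ranges of X and Y, the error of the Boolean sum of A and
    B does not change when F is replaced by U = (I - Y) (I - X) F. *)
Lemma bool_sum_reproduce (R : realType) (a b c d : R) A B X Y (F : R * R -> R) z :
  is_nodal a b A -> is_nodal c d B ->
  (forall f, A (X f) = X f) -> (forall f, B (Y f) = Y f) ->
  let W := F \- liftx X F in let U := W \- lifty Y W in
  F z - bool_sum (liftx A) (lifty B) F z = U z - bool_sum (liftx A) (lifty B) U z.
Proof.
move=> nA nB AX BY W U.
have PX G : liftx A (liftx X G) = liftx X G.
  by apply/funext => w; rewrite /liftx /= AX.
have QY G : lifty B (lifty Y G) = lifty Y G.
  by apply/funext => w; rewrite /lifty /= BY.
have QU : lifty B U = lifty B W \- lifty Y W by rewrite (liftyB _ _ nB) QY.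
have PW : liftx A W = liftx A F \- liftx X F by rewrite (liftxB _ _ nA) PX.
have QW : lifty B W = lifty B F \- lifty B (liftx X F) by rewrite (liftyB _ _ nB).
have QPW : lifty B (liftx A W) = lifty B (liftx A F) \- lifty B (liftx X F).
  by rewrite PW (liftyB _ _ nB).
have PU : liftx A U = liftx A W \- liftx A (lifty Y W) by rewrite (liftxB _ _ nA).
have PQU : liftx A (lifty B U) = lifty B (liftx A W) \- liftx A (lifty Y W).
  by rewrite QU (liftxB _ _ nA) (lift_comm _ nA nB).
rewrite /bool_sum PQU PU QU QPW PW QW (lift_comm _ nA nB) /=.
by rewrite /U /W /=; ring.
Qed.

(** The interpolation error in the second variable for the section at x of
    (I - X) F; the derivatives of that section are themselves interpolation errors in
    the first variable. *)
Lemma residual_le (R : realType) (a b c d S : R) (F : R * R -> R) N1 N2 z :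
  a < b -> c < d ->
  (forall j x, (j < N2)%N -> x \in `[a, b] -> within_deriv c d
     (fun y => partial a b c d 0 j F (x, y)) (fun y => partial a b c d 0 j.+1 F (x, y))) ->
  (forall i y, (i < N1)%N -> y \in `[c, d] -> within_deriv a b
     (fun x => partial a b c d i N2 F (x, y)) (fun x => partial a b c d i.+1 N2 F (x, y))) ->
  (forall w, rect a b c d w -> `|partial a b c d N1 N2 F w| <= S) ->
  rect a b c d z ->
  let W := F \- liftx (interp a b N1) F in
  `|(W \- lifty (interp c d N2) W) z|
  <= S / N1`!%:R * ((b - a) / 2) ^+ N1 / N2`!%:R * ((d - c) / 2) ^+ N2.
Proof.
move=> ab cd dy dx FS; case: z => x y [/= xab ycd].
(* The derivative of order j of the section at x of (I - X) F. *)
pose g j y' := partial a b c d 0 j F (x, y')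
  - interp a b N1 (fun x' => partial a b c d 0 j F (x', y')) x.
apply: (@interp_sym_error _ c d _ N2 g y cd) => //.
  move=> j jN; apply: within_derivB; first exact: dy.
  apply: (@within_deriv_sum _ c d _
    (fun s y' => partial a b c d 0 j F (sym_node a b s, y'))) => s.
  by apply: dy => //; apply: sym_node_itv.
move=> y' y'cd.
apply: (@interp_sym_error _ a b S N1 (fun i x' => partial a b c d i N2 F (x', y'))) => //.
  by move=> i iN; apply: dx.
by move=> x' x'ab; apply: FS.
Qed.

Lemma class_C_dy (R : realType) (a b c d : R) M N (F : R * R -> R) j x :
  class_C a b c d M N F -> (j < N)%N -> x \in `[a, b] -> within_deriv c d
     (fun y => partial a b c d 0 j F (x, y)) (fun y => partial a b c d 0 j.+1 F (x, y)).
Proof. by move=> [Fy _ _] jN xab y ycd; apply: (Fy j (x, y)). Qed.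

Lemma class_C_dx (R : realType) (a b c d : R) M N (F : R * R -> R) i j y :
  class_C a b c d M N F -> (i < M)%N -> (j <= N)%N -> y \in `[c, d] -> within_deriv a b
     (fun x => partial a b c d i j F (x, y)) (fun x => partial a b c d i.+1 j F (x, y)).
Proof. by move=> [_ Fx _] iM jN ycd x xab; apply: (Fx i j (x, y)). Qed.

Lemma rect_corner (R : realType) (a b c d : R) : a < b -> c < d -> rect a b c d (a, c).
Proof. by move=> ab cd; split; rewrite /= in_itv /= lexx ltW. Qed.

Lemma supnorm_ge0 (R : realType) T (D : set T) (f : T -> R) z : D z ->
  (0 <= supnorm D f)%E.
Proof. by move=> Dz; apply: le_trans (supnorm_ge f Dz); rewrite lee_fin. Qed.

Lemma opnorm_ub (R : realType) (a b c d : R) T (G : R * R -> R) z :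
  {within rect a b c d, continuous G} ->
  (forall w, rect a b c d w -> `|G w| <= 1) -> rect a b c d z ->
  (`|T G z|%:E <= opnorm a b c d T)%E.
Proof.
move=> cG G1 zI; apply: le_trans (supnorm_ge _ zI) _.
by apply: ereal_sup_ubound; exists G => //; split=> //; apply: supnorm_le.
Qed.

Lemma opnorm_ge0 (R : realType) (a b c d : R) T : a < b -> c < d ->
  (0 <= opnorm a b c d T)%E.
Proof.
move=> ab cd; apply: le_trans (@opnorm_ub _ a b c d T (fun=> 0) (a, c) _ _ _).
- by rewrite lee_fin.
- by apply: continuous_subspaceT => x; apply: cst_continuous.
- by move=> w _; rewrite normr0.
- exact: rect_corner.
Qed.

Lemma opnorm_bool_sum_le (R : realType) (a b c d : R) A B K L :
  is_nodal a b A -> is_nodal c d B -> bounded_by a b A K -> bounded_by c d B L ->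
  (opnorm a b c d (bool_sum (liftx A) (lifty B)) <= (K + L + K * L)%:E)%E.
Proof.
move=> nA nB bA bB; apply: ge_ereal_sup => _ [G [cG G1] <-].
apply: supnorm_le => z zI; rewrite -[leRHS]mulr1.
apply: (bool_sum_le nA nB bA bB cG) => // w wI.
by rewrite -lee_fin; apply: le_trans G1; apply: supnorm_ge.
Qed.

Lemma bool_sumZ (R : realType) (a b c d k : R) A B (G : R * R -> R) :
  is_nodal a b A -> is_nodal c d B ->
  bool_sum (liftx A) (lifty B) (fun z => k * G z)
  = fun z => k * bool_sum (liftx A) (lifty B) G z.
Proof.
move=> nA nB; apply/funext => z; rewrite /bool_sum.
by rewrite (liftyZ _ _ nB) !(liftxZ _ _ nA); ring.
Qed.

(** The operator norm of a Boolean sum is a real number w, and w bounds the operator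
    on functions of arbitrary norm.  Functions of norm 0, which cannot be rescaled,
    are covered by [bool_sum_le]. *)
Lemma opnorm_bool_sumP (R : realType) (a b c d : R) A B K L :
  a < b -> c < d ->
  is_nodal a b A -> is_nodal c d B -> bounded_by a b A K -> bounded_by c d B L ->
  exists w, [/\ 0 <= w, opnorm a b c d (bool_sum (liftx A) (lifty B)) = w%:E &
    forall G s, {within rect a b c d, continuous G} ->
      (forall z, rect a b c d z -> `|G z| <= s) -> forall z, rect a b c d z ->
      `|bool_sum (liftx A) (lifty B) G z| <= w * s].
Proof.
move=> ab cd nA nB bA bB; set T := bool_sum _ _.
have Tub := opnorm_bool_sum_le nA nB bA bB.
have Tge := opnorm_ge0 T ab cd.
have Tfin : opnorm a b c d T \is a fin_num.
  by rewrite ge0_fin_numE // (le_lt_trans Tub) // ltry.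
exists (fine (opnorm a b c d T)); split; rewrite ?fine_ge0 ?fineK //.
move=> G s cG Gs z zI.
have := le_trans (normr_ge0 _) (Gs z zI); rewrite le_eqVlt => /orP[/eqP s0|s0].
  have := bool_sum_le nA nB bA bB cG Gs zI.
  by rewrite -s0 !mulr0.
have TG : T (fun z => s^-1 * G z) = fun z => s^-1 * T G z by exact: (bool_sumZ s^-1 G nA nB).
have := @opnorm_ub _ a b c d T (fun z => s^-1 * G z) z _ _ zI.
rewrite TG -{1}(fineK Tfin) lee_fin => H.
rewrite -ler_pdivrMr // mulrC -[s^-1]gtr0_norm ?invr_gt0 // -normrM.
apply: H.
  apply/subspace_continuousP => x xI; apply: cvgM; first exact: cvg_cst.
  by move/subspace_continuousP : cG; exact.
move=> v vI; rewrite normrM gtr0_norm ?invr_gt0 // ler_pdivrMl // mulr1.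
exact: Gs.
Qed.

(** Error of a single Boolean sum.  N1 and N2 are the numbers of reproduced powers,
    that is the degrees plus one. *)
Lemma bool_sum_error (R : realType) (a b c d h K L : R) A B M N N1 N2 (F : R * R -> R) z :
  a < b -> c < d -> b - a = h -> d - c = h ->
  is_nodal a b A -> is_nodal c d B -> bounded_by a b A K -> bounded_by c d B L ->
  (forall p : {poly R}, (size p <= N1)%N -> A (horner p) = horner p) ->
  (forall p : {poly R}, (size p <= N2)%N -> B (horner p) = horner p) ->
  class_C a b c d M N F -> (N1 <= M)%N -> (N2 <= N)%N -> rect a b c d z ->
  (`|F z - bool_sum (liftx A) (lifty B) F z|%:E
   <= (1 + opnorm a b c d (bool_sum (liftx A) (lifty B)))
      * (supnorm (rect a b c d) (partial a b c d N1 N2 F)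
         * ((2 ^+ (N1 + N2) * N1`!%:R * N2`!%:R)^-1)%:E)
      * (h ^+ (N1 + N2))%:E)%E.
Proof.
move=> ab cd hab hcd nA nB bA bB rA rB FC N1M N2N zI.
have h0 : 0 < h by rewrite -hab subr_gt0.
have [w [w0 -> Tw]] := opnorm_bool_sumP ab cd nA nB bA bB.
have c0 : 0 < (2 ^+ (N1 + N2) * N1`!%:R * N2`!%:R)^-1 :> R.
  by rewrite invr_gt0 !mulr_gt0 ?exprn_gt0 ?ltr0n ?fact_gt0.
have := supnorm_ge0 (partial a b c d N1 N2 F) zI.
(* If the derivative were unbounded, the right-hand side would be infinite. *)
case SE : (supnorm _ _) => [S| |] // S0; last first.
  rewrite gt0_mulye ?lte_fin // gt0_muley; last by rewrite -EFinD lte_fin ltr_wpDr.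
  by rewrite gt0_mulye ?leey // lte_fin exprn_gt0.
have FS v : rect a b c d v -> `|partial a b c d N1 N2 F v| <= S.
  by move=> vI; rewrite -lee_fin -SE; apply: supnorm_ge.
rewrite -EFinD -!EFinM lee_fin.
have cF : {within rect a b c d, continuous F}.
  by have [_ _ /(_ 0%N 0%N isT isT)] := FC.
have nI := @is_nodal_interp R a b N1 ab; have nJ := @is_nodal_interp R c d N2 cd.
rewrite (@bool_sum_reproduce _ a b c d A B (interp a b N1) (interp c d N2)) //; last first.
- by move=> f; rewrite /interp nodalE rB // size_interp.
- by move=> f; rewrite /interp nodalE rA // size_interp.
set W := F \- _; set U := W \- _.
have cU : {within rect a b c d, continuous U}.
  have cW : {within rect a b c d, continuous W}.
    by apply: within_continuousB => //; apply: liftx_continuous.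
  by apply: within_continuousB => //; apply: lifty_continuous.
pose s := S * (2 ^+ (N1 + N2) * N1`!%:R * N2`!%:R)^-1 * h ^+ (N1 + N2).
have Us v : rect a b c d v -> `|U v| <= s.
  move=> vI; apply: le_trans (@residual_le _ a b c d S F N1 N2 v ab cd _ _ FS vI) _.
  - by move=> j x jN; apply: (class_C_dy FC); exact: leq_trans N2N.
  - by move=> i y iN; apply: (class_C_dx FC); rewrite // (leq_trans iN).
  rewrite hab hcd /s !exprD !exprMn !exprVn le_eqVlt; apply/orP; left; apply/eqP.
  by field; rewrite !pnatr_eq0 -!lt0n !fact_gt0 !expf_neq0.
rewrite -mulrA -mulrA [S * _]mulrA -/s [leRHS]mulrDl mul1r.
by rewrite (le_trans (ler_normB _ _)) // lerD ?Us // Tw.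
Qed.

(** * The chain of projectors *)

(** The univariate projector of level k - 1, with the zero operator as the projector
    of level -1. *)
Definition level_proj (R : realType) (a b : R) (r : nat) (m : nat -> nat) (k : nat) :
    (R -> R) -> R -> R :=
  if k is k'.+1 then Defs.proj a b (m r) (m k') else fun _ _ => 0.

(** The bound of the norm of [level_proj]. *)
Definition level_const (R : realType) (C : nat -> R) (r : nat) (m : nat -> nat) (k : nat) : R :=
  if k is k'.+1 then proj_const C (m r) (m k') else 0.

Lemma projx_prevE (R : realType) (a b : R) r m k :
  projx_prev a b r m k = liftx (level_proj a b r m k).
Proof. by case: k. Qed.

Lemma projy_prevE (R : realType) (c d : R) r n l :
  projy_prev c d r n l = lifty (level_proj c d r n l).
Proof. by case: l. Qed.

(** The degrees m_0, ..., m_r increase strictly, each dividing the next. *)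
Definition dvd_chain (r : nat) (m : nat -> nat) : Prop :=
  forall k, (k < r)%N -> (m k < m k.+1)%N /\ (m k %| m k.+1)%N.

Lemma dvd_chainP r m k l : dvd_chain r m -> (k <= l)%N -> (l <= r)%N ->
  (m k <= m l)%N /\ (m k %| m l)%N.
Proof.
move=> mc; elim: l => [|l IH]; first by rewrite leqn0 => /eqP -> _.
rewrite leq_eqVlt => /orP[/eqP -> //|kl] lr.
have [m1 d1] := IH kl (ltnW lr); have [m2 d2] := mc l lr.
by split; [exact: leq_trans m1 (ltnW m2)|exact: dvdn_trans d1 d2].
Qed.

Lemma is_nodal_level (R : realType) (a b : R) r m k : a < b ->
  is_nodal a b (level_proj a b r m k).
Proof. by case: k => [|k] ab; [exact: is_nodal0|exact: is_nodal_proj]. Qed.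

Lemma level_proj_bounded (R : realType) (a b : R) C r m k : a < b -> dvd_chain r m ->
  lambda_bound a b (m r) (C (m r)) -> (k <= r.+1)%N ->
  bounded_by a b (level_proj a b r m k) (level_const C r m k).
Proof.
move=> ab mc Cb; case: k => [|k] kr f s cf fs x xab /=; first by rewrite normr0 mul0r.
rewrite ltnS in kr; have [kr_le kr_dvd] := dvd_chainP mc kr (leqnn r).
exact: proj_le.
Qed.

Lemma level_proj_poly (R : realType) (a b : R) r m k (p : {poly R}) : a < b ->
  dvd_chain r m -> (k <= r.+1)%N -> (size p <= succ_deg m k)%N ->
  level_proj a b r m k (horner p) = horner p.
Proof.
move=> ab mc; case: k => [|k] kr /=.
  by rewrite leqn0 size_poly_eq0 => /eqP ->; apply/funext => x; rewrite horner0.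
rewrite ltnS in kr; have [kr_le kr_dvd] := dvd_chainP mc kr (leqnn r).
exact: proj_poly.
Qed.

Lemma level_proj_comp (R : realType) (a b : R) r m k l f : a < b ->
  dvd_chain r m -> (k <= r.+1)%N -> (l <= r.+1)%N ->
  level_proj a b r m k (level_proj a b r m l f) = level_proj a b r m (minn k l) f.
Proof.
move=> ab mc; case: k l => [|k] [|l] kr lr //=.
  have [q [t [u [_ E]]]] := @is_nodal_proj R a b (m r) (m k) ab.
  by rewrite E; apply/funext => x; apply: big1 => s _; rewrite mul0r.
rewrite ltnS in kr; rewrite ltnS in lr; rewrite minnSS; have [kl|lk] := leqP k l.
  have [kl_le kl_dvd] := dvd_chainP mc kl lr.
  have [lr_le lr_dvd] := dvd_chainP mc lr (leqnn r).
  exact: proj_proj_le.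
have [lk_le lk_dvd] := dvd_chainP mc (ltnW lk) kr.
have [kr_le kr_dvd] := dvd_chainP mc kr (leqnn r).
have [lr_le lr_dvd] := dvd_chainP mc lr (leqnn r).
exact: proj_proj_ge.
Qed.

Lemma leq_succ_deg r m k l : dvd_chain r m -> (k <= l)%N -> (l <= r.+1)%N ->
  (succ_deg m k <= succ_deg m l)%N.
Proof.
move=> mc; case: k l => [|k] [|l] // kl lr; rewrite !ltnS in kl lr.
by rewrite ltnS; have [] := dvd_chainP mc kl lr.
Qed.

Lemma bigmin_ord_le (x : nat) n (f : nat -> nat) j : (j < n)%N ->
  (\big[minn/x]_(k < n) f k <= f j)%N.
Proof.
elim: n f j => [//|n IH] f [|j] jn; rewrite big_ord_recl ?geq_minl //.
by rewrite geq_min (IH (fun k => f k.+1)) ?orbT.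
Qed.

Lemma blend_residual (R : realType) (a b c d : R) r m n (F : R * R -> R) z :
  a < b -> c < d -> dvd_chain r m -> dvd_chain r n ->
  let e k l := F z - bool_sum (projx_prev a b r m k) (projy_prev c d r n l) F z in
  F z - blend a b c d r m n F z
  = \sum_(k < r.+2) e k (r.+1 - k)%N - \sum_(k < r.+1) e k.+1 (r - k).+1.
Proof.
move=> ab cd mc nc e.
pose P k := liftx (level_proj a b r m k); pose Q l := lifty (level_proj c d r n l).
pose X k l f := P k (Q l f).
have nP k : is_nodal a b (level_proj a b r m k) by exact: is_nodal_level.
have nQ l : is_nodal c d (level_proj c d r n l) by exact: is_nodal_level.
have X0 k : X k 0%N F = fun=> 0.
  have [q [t [u [_ E]]]] := nP k.
  by rewrite /X /P E; apply/funext => w; apply: big1 => s _; rewrite mul0r.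
have -> : blend a b c d r m n F
    = fun z => \sum_(k < r.+1) (X k.+1 (r - k).+1 F z - X k.+1 (r - k)%N F z).
  apply: (@bool_sum_chain R r X F _ _ X0) => [k l f g|k l f g|k l k' l' f kr lr kr' lr'].
  - by rewrite /X /P /Q (liftyB _ _ (nQ l)) (liftxB _ _ (nP k)).
  - by rewrite /X /P /Q (liftyD _ _ (nQ l)) (liftxD _ _ (nP k)).
  rewrite /X /P /Q -(lift_comm _ (nP k') (nQ l)).
  apply/funext => w; rewrite /liftx /= level_proj_comp //; congr (level_proj _ _ _ _ _ _ _).
  by apply/funext => x; rewrite /lifty /= level_proj_comp.
rewrite (@bool_sum_residual R r (F z) (fun k => P k F z) (fun l => Q l F z)
  (fun k l => X k l F z)) //.
by rewrite /e; congr (_ - _); apply: eq_bigr => k _; rewrite projx_prevE projy_prevE.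
Qed.

(** One term of the error: the indices k and l are shifted by one. *)
Lemma K_const_error (R : realType) (a b c d h : R) C r m n (F : R * R -> R) z k l :
  a < b -> c < d -> b - a = h -> d - c = h -> dvd_chain r m -> dvd_chain r n ->
  lambda_bound a b (m r) (C (m r)) -> lambda_bound c d (n r) (C (n r)) ->
  class_C a b c d (m r).+1 (n r).+1 F -> rect a b c d z ->
  (k <= r.+1)%N -> (l <= r.+1)%N ->
  (`|F z - bool_sum (projx_prev a b r m k) (projy_prev c d r n l) F z|%:E
   <= K_const a b c d r m n F k l * (h ^+ (succ_deg m k + succ_deg n l))%:E)%E.
Proof.
move=> ab cd hab hcd mc nc Ca Cc FC zI kr lr; rewrite /K_const projx_prevE projy_prevE.
apply: (bool_sum_error ab cd hab hcd (is_nodal_level r m k ab) (is_nodal_level r n l cd)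
  (level_proj_bounded ab mc Ca kr) (level_proj_bounded cd nc Cc lr) _ _ FC _ _ zI).
- by move=> p; apply: level_proj_poly.
- by move=> p; apply: level_proj_poly.
- exact: (leq_succ_deg mc kr).
- exact: (leq_succ_deg nc lr).
Qed.

Lemma K_const_ge0 (R : realType) (a b c d : R) r m n (F : R * R -> R) k l :
  a < b -> c < d -> (0 <= K_const a b c d r m n F k l)%E.
Proof.
move=> ab cd; rewrite mule_ge0 ?adde_ge0 ?opnorm_ge0 // mule_ge0 //.
exact: supnorm_ge0 (rect_corner ab cd).
Qed.

Theorem theorem6p5 (R : realType) (C : nat -> R) (r : nat) (m n : nat -> nat)
    (a b c d h : R) (F : R * R -> R)
    (m_incr : forall k : nat, (k < r)%N -> (m k < m k.+1)%N)
    (n_incr : forall k : nat, (k < r)%N -> (n k < n k.+1)%N)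
    (m_dvd : forall k : nat, (k < r)%N -> (m k %| m k.+1)%N)
    (n_dvd : forall k : nat, (k < r)%N -> (n k %| n k.+1)%N)
    (ltab : a < b) (ltcd : c < d)
    (C_bound : forall N : nat,
       lambda_bound a b N (C N) /\ lambda_bound c d N (C N))
    (hab : b - a = h) (hcd : d - c = h)
    (FC : class_C a b c d (m r).+1 (n r).+1 F) :
  (h <= 1 ->
     (supnorm (rect a b c d) (fun z => F z - blend a b c d r m n F z)%R
      <= C_const a b c d r m n F * (h ^+ approx_order r m n)%:E)%E)
  /\
  (forall k l : nat, (k <= r)%N -> (l <= r)%N ->
     (opnorm a b c d
        (bool_sum (projx a b (m r) (m k)) (projy c d (n r) (n l)))
      <= (proj_const C (m r) (m k) + proj_const C (n r) (n l)
          + proj_const C (m r) (m k) * proj_const C (n r) (n l))%:E)%E).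
Proof.
have mc : dvd_chain r m by move=> k kr; split; [exact: m_incr|exact: m_dvd].
have nc : dvd_chain r n by move=> k kr; split; [exact: n_incr|exact: n_dvd].
have [Ca _] := C_bound (m r); have [_ Cc] := C_bound (n r).
split=> [h1|k l kr lr]; last first.
  exact: (opnorm_bool_sum_le (is_nodal_level r m k.+1 ltab) (is_nodal_level r n l.+1 ltcd)
    (level_proj_bounded (k := k.+1) ltab mc Ca kr) (level_proj_bounded (k := l.+1) ltcd nc Cc lr)).
have h0 : 0 < h by rewrite -hab subr_gt0.
apply: ge_ereal_sup => _ [z zI <-].
pose e k l := F z - bool_sum (projx_prev a b r m k) (projy_prev c d r n l) F z.
set p := approx_order r m n.
have eK k l : (k <= r.+1)%N -> (l <= r.+1)%N -> (p <= succ_deg m k + succ_deg n l)%N ->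
    (`|e k l|%:E <= K_const a b c d r m n F k l * (h ^+ p)%:E)%E.
  move=> kr lr ple.
  apply: le_trans (K_const_error ltab ltcd hab hcd mc nc Ca Cc FC zI kr lr) _.
  by rewrite lee_wpmul2l ?K_const_ge0 // lee_fin ler_wiXn2l // ltW.
have p1 k : (k <= r.+1)%N -> (p <= order_term r m n k)%N.
  by move=> kr; apply: bigmin_ord_le.
rewrite (blend_residual _ _ ltab ltcd mc nc) -/e.
apply: (@le_trans _ _ (\sum_(k < r.+2) `|e k (r.+1 - k)%N|
  + \sum_(k < r.+1) `|e k.+1 (r - k).+1|)%:E).
  by rewrite lee_fin (le_trans (ler_normB _ _)) // lerD // ler_norm_sum.
rewrite EFinD -!sumEFin /C_const ge0_muleDl; last 2 first.
- by apply: sume_ge0 => k _; apply: K_const_ge0.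
- by apply: sume_ge0 => k _; apply: K_const_ge0.
apply: leeD; rewrite ge0_sume_distrl; try by move=> k _; apply: K_const_ge0.
  apply: lee_sum => k _; apply: eK; rewrite ?leq_subr ?p1 //; exact: leq_ord.
apply: lee_sum => k _; have kr := leq_ord k.
apply: eK; rewrite ?ltnS ?leq_subr //.
apply: leq_trans (p1 k (leqW kr)) _; rewrite /order_term subSn // leq_add2r.
exact: (leq_succ_deg mc (leqnSn k)).
Qed.
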